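(* Let $\Omega$, $\mathcal{T}_h$, $V_h$, $I_\tau$, $\langle\cdot,\cdot\rangle$, $\langle\cdot,\cdot\rangle_h$, $\alpha,\beta\ge 0$, $k,q\ge 1$ be as in the context. Let $\psi_h,p_h\in P_q(I_\tau;V_h)\cap H^1([0,T];V_h)$ satisfy $\psi_h(0)=\psi_{h,0}$, $p_h(0)=p_{h,0}$ for given initial values $\psi_{h,0},p_{h,0}\in V_h$, and, for all grid points $t^m,t^n$ of $I_\tau$ with $0\le t^m\le t^n\le T$ and all $\widetilde\eta_h,\widetilde q_h\in P_{q-1}(I_\tau;V_h)$, $$\int_{t^m}^{t^n}\langle(1-2\beta p_h)\,\partial_t p_h,\widetilde\eta_h\rangle_h+\alpha\langle\nabla\partial_t\psi_h,\nabla\widetilde\eta_h\rangle\,dt=-\int_{t^m}^{t^n}\langle\nabla\psi_h,\nabla\widetilde\eta_h\rangle\,dt,$$ $$-\int_{t^m}^{t^n}\langle(1-2\beta p_h)\,\partial_t\psi_h,\widetilde q_h\rangle_h\,dt=-\int_{t^m}^{t^n}\langle(1-2\beta p_h)\,p_h,\widetilde q_h\rangle_h\,dt.$$ Then, for all grid points $t^m,t^n$ of $I_\tau$ with $0\le t^m\le t^n\le T$, $$\mathcal{E}_h(\psi_h(t^n),p_h(t^n))=\mathcal{E}_h(\psi_h(t^m),p_h(t^m))-\alpha\int_{t^m}^{t^n}\int_\Omega|\nabla\partial_t\psi_h(s)|^2\,dx\,ds.$$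
   Context: $\Omega$ is a bounded domain with a geometrically conforming simplicial partition $\mathcal{T}_h=\{K\}$ (shape-regular mesh), and $V_h=\{v\in H^1(\Omega): v|_K\in P_k(K)\ \forall K\in\mathcal{T}_h\}$ is the space of continuous piecewise polynomials of degree $\le k$. For $T>0$, $I_\tau=\{0=t^0<t^1<\dots<t^N=T\}$ is a partition of $[0,T]$, and $P_r(I_\tau;X)=\{v: v|_{[t^{n-1},t^n]}\in P_r([t^{n-1},t^n];X)\text{ for all } n\}$ is the space of $X$-valued piecewise polynomials in time of degree $\le r$ (not necessarily continuous across grid points). Functions in $P_q(I_\tau;V_h)\cap H^1([0,T];V_h)$ are thus the continuous-in-time piecewise polynomials of degree $\le q$ with values in $V_h$; their time derivative $\partial_t$ is taken piecewise. $\langle u,v\rangle=\int_\Omega u\,v\,dx$ (with $u\cdot v$ for vector fields) is the $L^2(\Omega)$ scalar product. $\langle u,v\rangle_h$ is an approximation of $\langle u,v\rangle$ obtained by numerical integration, i.e. $\langle u,v\rangle_h=\sum_j w_j\,u(x_j)v(x_j)$ for a fixed quadrature rule with finitely many points $x_j\in\overline\Omega$ and real weights $w_j$ (applied to continuous functions $u,v$ on $\overline\Omega$, such as products of functions in $V_h$), and it is assumed to be symmetric and positive definite on $V_h$. The discrete energy is, for $\psi_h,p_h\in V_h$, $$\mathcal{E}_h(\psi_h,p_h)=\langle\tfrac12\nabla\psi_h,\nabla\psi_h\rangle+\langle(\tfrac12-\tfrac{2\beta}{3}p_h)p_h,p_h\rangle_h.$$ *)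

(* Defs.v *)
From HB Require Import structures.
From mathcomp Require Import all_boot all_order all_algebra.
From mathcomp Require Import all_classical all_reals all_analysis.
From mathcomp Require Import(canonicals, coercions) mpoly.

Set Implicit Arguments.
Unset Strict Implicit.
Unset Printing Implicit Defensive.
Import Order.TTheory GRing.Theory Num.Theory.
Import numFieldNormedType.Exports.

Local Open Scope classical_set_scope.
Local Open Scope ring_scope.

Section measurable_rV.
Context (R : realType) (n : nat).

Let coor : 'I_n -> 'rV[R]_n -> measurableTypeR R := fun i x => x ord0 i.

Let rV_set0 : g_sigma_preimage coor set0.
Proof. exact: sigma_algebra0. Qed.

Let rV_setC A : g_sigma_preimage coor A -> g_sigma_preimage coor (~` A).
Proof. exact: sigma_algebraC. Qed.

Let rV_bigcup (F : (set 'rV[R]_n)^nat) :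
  (forall i, g_sigma_preimage coor (F i)) ->
  g_sigma_preimage coor (\bigcup_i F i).
Proof. exact: sigma_algebra_bigcup. Qed.

#[warning="-redundant-canonical-projection"]
HB.instance Definition _ :=
  @isMeasurable.Build (measure_tuple_display default_measure_display)
  'rV[R]_n (g_sigma_preimage coor) rV_set0 rV_setC rV_bigcup.

Lemma measurable_coord (i : 'I_n) :
  measurable_fun [set: 'rV[R]_n] (fun x => x ord0 i : measurableTypeR R).
Proof.
move=> _ Y mY; apply: sub_sigma_algebra => /=.
rewrite -bigcup_seq/=; exists i => /=; first by rewrite mem_index_enum.
by exists Y.
Qed.

Lemma measurable_fun_rV d (T : measurableType d) (f : T -> 'rV[R]_n) :
  (forall i, measurable_fun [set: T] (fun x => f x ord0 i : measurableTypeR R)) ->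
  measurable_fun [set: T] f.
Proof.
move=> mf _ Y mY; rewrite setTI.
have H : smallest (sigma_algebra [set: 'rV[R]_n])
   (\big[setU/set0]_(i < n) preimage_set_system setT (coor i) measurable)
   `<=` [set Y | measurable (f @^-1` Y)].
  apply: smallest_sub.
    split => /=.
    - by rewrite preimage_set0; exact: measurable0.
    - by move=> A /= mA; rewrite setTD -preimage_setC; exact: measurableC.
    - by move=> A mA /=; rewrite preimage_bigcup; apply: bigcup_measurable => k _; exact: mA.
  rewrite -bigcup_seq => A [i _ [B mB <-]] /=.
  rewrite setTI; have := mf i measurableT B mB.
  by rewrite setTI.
exact: H Y mY.
Qed.

End measurable_rV.

Section lebesgue_measure_rV.
Context (R : realType).

Definition cons_rV n (x : measurableTypeR R * 'rV[R]_n) : 'rV[R]_n.+1 :=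
  row_mx (x.1)%:M x.2 : 'rV[R]_(1 + n).

Let uncons n (x : 'rV[R]_n.+1) : measurableTypeR R * 'rV[R]_n :=
  (x ord0 ord0, \row_j x ord0 (lift ord0 j)).

Lemma cons_rV0 n x : @cons_rV n x ord0 ord0 = x.1.
Proof.
rewrite /cons_rV (_ : ord0 = lshift n (ord0 : 'I_1)); last exact: val_inj.
by rewrite (@row_mxEl _ 1 1 n) mxE eqxx mulr1n.
Qed.

Lemma cons_rVS n x j : @cons_rV n x ord0 (lift ord0 j) = x.2 ord0 j.
Proof.
rewrite /cons_rV (_ : lift ord0 j = rshift 1 j); last exact: val_inj.
by rewrite (@row_mxEr _ 1 1 n).
Qed.

Let consK n : cancel (@cons_rV n) (@uncons n).
Proof.
move=> x; rewrite /uncons cons_rV0 [RHS]surjective_pairing; congr pair.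
by apply/rowP => j; rewrite mxE cons_rVS.
Qed.

Lemma measurable_cons_rV n : measurable_fun setT (@cons_rV n).
Proof.
apply: measurable_fun_rV => i; have [->|[j ->]] : i = ord0 \/ exists j, i = lift ord0 j.
- by case: (unliftP ord0 i) => [j ->|->]; [right; exists j|left].
- by under eq_fun do rewrite cons_rV0; exact: measurable_fst.
- under eq_fun do rewrite cons_rVS.
  by apply: (measurableT_comp (measurable_coord j)); exact: measurable_snd.
Qed.

Let measurable_uncons n : measurable_fun setT (@uncons n).
Proof.
apply/measurable_fun_pairP; split => /=; first exact: measurable_coord.
apply: measurable_fun_rV => i /=.
under eq_fun do rewrite mxE; exact: measurable_coord.
Qed.

Fixpoint lebesgue_rV (n : nat) : set 'rV[R]_n -> \bar R :=
  match n with
  | 0 => dirac (0 : 'rV[R]_0)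
  | m.+1 => pushforward (@lebesgue_measure R \x @lebesgue_rV m)%E (@cons_rV m)
  end.

Let lebesgue_rV_ex n :
  exists mu : {sigma_finite_measure set 'rV[R]_n -> \bar R},
    lebesgue_rV (n := n) = mu.
Proof.
elim: n => [|n [mu muE]].
  exists ([the {sigma_finite_measure set _ -> \bar R} of
    @dirac _ 'rV[R]_0 (0 : 'rV[R]_0) R]).
  by [].
pose L : {sigma_finite_measure set (measurableTypeR R) -> \bar R} :=
  @lebesgue_measure R.
have [P PE] : exists P : {measure set (measurableTypeR R * 'rV[R]_n)%type -> \bar R},
    (L \x mu)%E = P by exists ((L \x mu)%E : measure _ R).
pose nu := pushforward P (@cons_rV n).
have nu0 : nu set0 = 0%E by rewrite /nu /pushforward preimage_set0 measure0.
have nu_ge0 A : (0 <= nu A)%E by rewrite /nu /pushforward measure_ge0.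
have nu_sa : semi_sigma_additive nu.
  move=> F mF tF mUF; rewrite /nu /pushforward preimage_bigcup.
  apply: measure_semi_sigma_additive.
  - by move=> k; rewrite -[X in measurable X]setTI; exact: measurable_cons_rV.
  - apply/trivIsetP => /= i j _ _ ij; rewrite -preimage_setI.
    by move/trivIsetP : tF => /(_ _ _ _ _ ij) ->//; rewrite preimage_set0.
  - by rewrite -preimage_bigcup -[X in measurable X]setTI; exact: measurable_cons_rV.
have nu_sf : sigma_finite setT nu.
  have /sigma_finiteP[F [TF ndF Foo]] := sigma_finiteT L.
  have /sigma_finiteP[G [TG ndG Goo]] := sigma_finiteT mu.
  exists (fun k => @uncons n @^-1` (F k `*` G k)).
    rewrite -preimage_bigcup -[LHS](preimage_setT (@uncons n)).
    congr (_ @^-1` _); apply/seteqP; split => // -[x y] _.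
    have [k _ Fkx] : (\bigcup_k F k) x by rewrite -TF.
    have [l _ Gly] : (\bigcup_k G k) y by rewrite -TG.
    exists (maxn k l) => //; split.
    - by move: x Fkx; exact/subsetPset/ndF/leq_maxl.
    - by move: y Gly; exact/subsetPset/ndG/leq_maxr.
  move=> k; have [mF PF] := Foo k; have [mG PG] := Goo k.
  have mFG : measurable (F k `*` G k) by exact: measurableX.
  split.
    by rewrite -[X in measurable X]setTI; exact: measurable_uncons.
  rewrite /nu /pushforward (_ : _ @^-1` _ = F k `*` G k); last first.
    by apply/seteqP; split => x; rewrite /preimage /mkset consK.
  by rewrite -PE product_measure1E// lte_mul_pinfty// ge0_fin_numE.
have nuE : @lebesgue_rV n.+1 = nu by rewrite /nu -PE -muE.
rewrite nuE; clear nuE; clearbody nu.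
pose nuM := isMeasure.Build _ _ _ nu nu0 nu_ge0 nu_sa.
pose nu1 : {measure set 'rV[R]_n.+1 -> \bar R} := HB.pack nu nuM.
pose nuS := Measure_isSigmaFinite.Build _ _ _ nu1 nu_sf.
pose nu2 : {sigma_finite_measure set 'rV[R]_n.+1 -> \bar R} := HB.pack nu nuM nuS.
by exists nu2.
Qed.

Let lebesgue_rV0 n : lebesgue_rV (set0 : set 'rV[R]_n) = 0%E.
Proof. by have [mu ->] := lebesgue_rV_ex n; exact: measure0. Qed.

Let lebesgue_rV_ge0 n (A : set 'rV[R]_n) : (0 <= lebesgue_rV A)%E.
Proof. by have [mu ->] := lebesgue_rV_ex n; exact: measure_ge0. Qed.

Let lebesgue_rV_sigma_additive n : semi_sigma_additive (@lebesgue_rV n).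
Proof.
by have [mu ->] := lebesgue_rV_ex n; exact: measure_semi_sigma_additive.
Qed.

HB.instance Definition _ n := isMeasure.Build _ _ _ (@lebesgue_rV n)
  (@lebesgue_rV0 n) (@lebesgue_rV_ge0 n) (@lebesgue_rV_sigma_additive n).

Let lebesgue_rV_sigma_finite n : sigma_finite setT (@lebesgue_rV n).
Proof. by have [mu ->] := lebesgue_rV_ex n; exact: sigma_finiteT. Qed.

HB.instance Definition _ n := Measure_isSigmaFinite.Build _ _ _
  (@lebesgue_rV n) (@lebesgue_rV_sigma_finite n).

Lemma lebesgue_rV_box n (A : 'I_n -> set (measurableTypeR R)) :
  (forall i, measurable (A i)) ->
  lebesgue_rV [set x : 'rV[R]_n | forall i, A i (x ord0 i)] =
  (\prod_(i < n) (@lebesgue_measure R (A i)))%E.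
Proof.
elim: n A => [|n IH] A mA.
  rewrite big_ord0 /= diracE mem_set//; by case.
rewrite big_ord_recl -IH//=.
rewrite -product_measure1E//; last first.
  rewrite (_ : mkset _ = \bigcap_i [set x : 'rV[R]_n |
    (if insub i is Some j then A (lift ord0 j) (x ord0 j) else True)]).
    apply: bigcap_measurable; first by exists 0.
    move=> k _; case: insubP => [j _ _|_]; last exact: measurableT.
    by rewrite -[X in measurable X]setTI; exact: measurable_coord.
  apply/seteqP; split => x /= xA.
    by move=> i _ /=; case: insubP => //.
  by move=> i; have := xA (val i) I; rewrite /= valK.
rewrite /pushforward; congr product_measure1.
apply/seteqP; split => -[x y] /=.
  move=> xA; split; first by have := xA ord0; rewrite cons_rV0.
  by move=> i; have := xA (lift ord0 i); rewrite cons_rVS.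
move=> [xA yA] i; case: (unliftP ord0 i) => [j ->|->]; first by rewrite cons_rVS.
by rewrite cons_rV0.
Qed.

End lebesgue_measure_rV.

Arguments lebesgue_rV : clear implicits.

Section euclidean.
Context (R : realType) (d : nat).
Implicit Types (x y : 'rV[R]_d) (Om : set 'rV[R]_d).

Definition dot x y : R := \sum_(i < d) x ord0 i * y ord0 i.

(* The norm `|_| of 'rV[R]_d is the sup norm. *)
Definition enorm x : R := Num.sqrt (dot x x).

Definition bounded_domain Om :=
  [/\ open Om, connected Om, Om !=set0 & bounded_set Om].

End euclidean.

Section sobolev.
Context (R : realType) (d : nat).
Implicit Types (Om : set 'rV[R]_d) (u v phi : 'rV[R]_d -> R)
  (F G : 'rV[R]_d -> 'rV[R]_d).

Definition partial (i : 'I_d) phi : 'rV[R]_d -> R :=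
  fun x => 'D_(delta_mx ord0 i) phi x.

Fixpoint Cn (n : nat) phi : Prop :=
  match n with
  | 0 => continuous phi
  | m.+1 => continuous phi /\ forall i,
      (forall x, derivable phi x (delta_mx ord0 i)) /\ Cn m (partial i phi)
  end.

Definition test_function Om phi := [/\ forall n, Cn n phi,
  compact (closure [set x | phi x != 0]) &
  closure [set x | phi x != 0] `<=` Om].

Definition L2 Om u := u \_ Om \in Lfun (lebesgue_rV R d) 2%:E.

Definition is_weak_grad Om v G := forall i : 'I_d,
  L2 Om (fun x => G x ord0 i) /\
  forall phi, test_function Om phi ->
    \int[lebesgue_rV R d]_(x in Om) (v x * partial i phi x) =
    - \int[lebesgue_rV R d]_(x in Om) (G x ord0 i * phi x).

Definition H1 Om v := L2 Om v /\ exists G, is_weak_grad Om v G.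

(* A representative of the weak gradient, which is unique almost everywhere
   for v in H1 Om. *)
Definition grad Om v : 'rV[R]_d -> 'rV[R]_d := get [set G | is_weak_grad Om v G].

Definition ip_vec Om F G : R :=
  \int[lebesgue_rV R d]_(x in Om) dot (F x) (G x).

End sobolev.

Section finite_elements.
Context (R : realType) (d : nat).
Implicit Types (A B : 'M[R]_(d.+1, d)) (Om : set 'rV[R]_d).

(* The rows of A are the vertices of a simplex; face A I is the convex hull of
   those indexed by I, so that face A set0 is empty. *)
Definition face A (I : {set 'I_d.+1}) : set 'rV[R]_d :=
  [set x | exists l : 'rV[R]_d.+1,
    [/\ forall i, 0 <= l ord0 i, forall i, i \notin I -> l ord0 i = 0,
        \sum_i l ord0 i = 1 & x = l *m A]].

Definition simplex A := face A [set: 'I_d.+1]%SET.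

Definition nondegenerate A := row_free (row_mx A (const_mx 1 : 'cV[R]_d.+1)).

Definition conforming_mesh Om (M : nat) (T : 'I_M -> 'M[R]_(d.+1, d)) :=
  [/\ forall a, nondegenerate (T a),
      closure Om = \bigcup_a simplex (T a) &
      forall a b, a != b -> exists I J : {set 'I_d.+1},
        [/\ I != [set: 'I_d.+1]%SET,
            simplex (T a) `&` simplex (T b) = face (T a) I &
            simplex (T a) `&` simplex (T b) = face (T b) J]].

Definition shape_regular (sigma : R) (M : nat) (T : 'I_M -> 'M[R]_(d.+1, d)) :=
  forall a, exists (c : 'rV[R]_d) (rho : R), [/\ 0 < rho,
    [set x | enorm (x - c) <= rho] `<=` simplex (T a) &
    forall x y, simplex (T a) x -> simplex (T a) y ->
      enorm (x - y) <= sigma * rho].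

Definition Pk (k : nat) (D : set 'rV[R]_d) (v : 'rV[R]_d -> R) :=
  exists2 p : mpoly.mpoly d R, (mpoly.msize p <= k.+1)%N &
    forall x, D x -> v x = mpoly.meval (x ord0) p.

(* A class of H1 Om that is piecewise polynomial is identified with its
   representative that is continuous on the closure of Om; the values of v
   outside that closure are irrelevant here and below. *)
Definition Vh Om (M : nat) (T : 'I_M -> 'M[R]_(d.+1, d)) (k : nat) :
    set ('rV[R]_d -> R) :=
  [set v | [/\ H1 Om v, {within closure Om, continuous v} &
               forall a, Pk k (simplex (T a)) v]].

End finite_elements.

Section quadrature.
Context (R : realType) (d J : nat).
Implicit Types (w : 'I_J -> R) (y : 'I_J -> 'rV[R]_d) (u v : 'rV[R]_d -> R).

(* Symmetric by construction. *)
Definition ip_quad w y u v : R := \sum_(j < J) w j * (u (y j) * v (y j)).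

Definition quad_posdef (D : set 'rV[R]_d) (V : set ('rV[R]_d -> R)) w y :=
  forall v, V v -> (exists2 x, D x & v x != 0) -> 0 < ip_quad w y v v.

End quadrature.

Section time.
Context (R : realType) (d : nat).
Implicit Types (D : set 'rV[R]_d) (V : set ('rV[R]_d -> R))
  (tau : nat -> R) (v : R -> 'rV[R]_d -> R).

Definition time_grid (Tf : R) (N : nat) tau :=
  [/\ tau 0 = 0, tau N = Tf & forall n, (n < N)%N -> tau n < tau n.+1].

(* Piecewise polynomials are determined up to their values at the grid points,
   whence the open intervals. *)
Definition Pr (N : nat) tau (r : nat) V D v :=
  forall n, (n < N)%N -> exists c : 'I_r.+1 -> 'rV[R]_d -> R,
    (forall j, V (c j)) /\
    forall t x, tau n < t < tau n.+1 -> D x ->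
      v t x = \sum_(j < r.+1) t ^+ j * c j x.

(* P_q(I_tau; V) `&` H1([0, T]; V): since V is finite-dimensional, continuity
   in time may be expressed pointwise in D. *)
Definition cPr (N : nat) tau (q : nat) V D v :=
  Pr N tau q V D v /\
  forall x, D x -> {within `[tau 0, tau N], continuous (fun t => v t x)}.

(* The piecewise time derivative; only its values off the grid matter. *)
Definition dt v : R -> 'rV[R]_d -> R := fun t x => derive1 (v^~ x) t.

End time.

Definition energy_h (R : realType) (d J : nat) (Om : set 'rV[R]_d)
    (w : 'I_J -> R) (y : 'I_J -> 'rV[R]_d) (beta : R) (psi p : 'rV[R]_d -> R) : R :=
  ip_vec Om (fun x => 2^-1 *: grad Om psi x) (grad Om psi) +
  ip_quad w y (fun x => (2^-1 - 2 * beta / 3 * p x) * p x) p.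

(* Main.v *)
(* Testing the first equation with the time derivative of psi and the second one
   with that of p makes the coupling terms cancel; what remains on each time
   slab is the integral of the derivative of the energy, a polynomial in time.

   Since grad picks an arbitrary weak gradient, the bilinearity of ip_vec Om
   (grad Om _) (grad Om _) rests on the almost everywhere uniqueness of weak
   gradients, that is, on the fundamental lemma of the calculus of variations.
   The latter is obtained by approximating indicator functions of boxes by
   products of exp(-1/t) bumps and by Dynkin's pi-lambda theorem. *)
Require Import Defs.
From mathcomp Require Import all_boot all_order all_algebra.
From mathcomp Require Import all_classical all_reals all_analysis.
From mathcomp Require Import measurable_realfun ring lra.
From mathcomp Require Import(canonicals, coercions) mpoly.

Set Implicit Arguments.
Unset Strict Implicit.
Unset Printing Implicit Defensive.
Import Order.TTheory GRing.Theory Num.Theory.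
Import numFieldNormedType.Exports.

Local Open Scope classical_set_scope.
Local Open Scope ring_scope.

(** The factor 2/3 in the energy is the one for which (1/2 - 2 beta/3 p) p^2 has the time derivative
    (1 - 2 beta p) p p', the term left by the second equation once tested. Differentiation in time
    lowers the degree from q to q - 1 and keeps the spatial coefficients in V_h, so both time
    derivatives are admissible test functions. On a slab every integrand becomes a real polynomial
    in t: the gradient terms through the constant matrix of inner products of the gradients of the
    spatial coefficients, the quadrature terms through the nodal values. This replaces
    differentiation under the spatial integral.

    Two obstacles shape the rest. The polynomial expansions hold only inside the slabs, so the
    energies at grid points are reached by continuity. And the real-valued integral is additive only
    on integrable functions, so integrability is carried along with the identities, both in space
    and in time. *)

(** * The flat function exp(-1/t) and its derivatives *)

Section flatexp.
Context {R : realType}.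

(** The powers of 1/t make the family stable under differentiation up to linear combinations. *)
Definition flatexp (n : nat) (t : R) : R :=
  if 0 < t then t^-1 ^+ n * expR (- t^-1) else 0.

Lemma flatexp0_ge0 t : 0 <= flatexp 0 t.
Proof. by rewrite /flatexp; case: ifP => // _; rewrite expr0 mul1r expR_ge0. Qed.

Lemma flatexp0_le1 t : flatexp 0 t <= 1.
Proof.
rewrite /flatexp; case: ifP => // t0.
by rewrite expr0 mul1r -expR0 ler_expR oppr_le0 invr_ge0 ltW.
Qed.

(* From (s / n.+1) ^+ n.+1 <= expR s at s = t^-1. *)
Lemma flatexp_le n t : `|flatexp n t| <= n.+1%:R ^+ n.+1 * `|t|.
Proof.
rewrite /flatexp; case: ifPn => [t0|_]; last by rewrite normr0 mulr_ge0 ?exprn_ge0.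
rewrite normrM normrX normfV (gtr0_norm t0) (gtr0_norm (expR_gt0 _)).
rewrite expRN ler_pdivrMr ?expR_gt0// mulrAC -ler_pdivrMr// -exprSr.
have -> : t^-1 = n.+1%:R * (t^-1 / n.+1%:R).
  by rewrite mulrC -mulrA mulVf ?mulr1// pnatr_eq0.
rewrite expRM_natl exprMn; apply: ler_wpM2l; first exact: exprn_ge0.
have x0 : 0 <= t^-1 / n.+1%:R by rewrite divr_ge0// invr_ge0 ltW.
apply: lerXn2r; rewrite ?nnegrE ?expR_ge0//.
by rewrite (le_trans _ (expR_ge1Dx _))// lerDr.
Qed.

(** Turns the difference quotient of [flatexp n] at 0 into [flatexp n.+1], which tends to 0. *)
Lemma flatexp_scaleV n t : t^-1 * flatexp n t = flatexp n.+1 t.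
Proof. by rewrite /flatexp; case: ifP => _; rewrite ?mulr0// mulrA -exprS. Qed.

Lemma flatexp_at0 n : flatexp n 0 = 0.
Proof. by rewrite /flatexp ltxx. Qed.

Lemma cvg_flatexp n : flatexp n t @[t --> 0] --> 0.
Proof.
apply/cvgr0Pnorm_le => e e0; near=> t.
rewrite (le_trans (flatexp_le _ _))// -ler_pdivlMl ?exprn_gt0//.
near: t; apply: cvgr0_norm_le; last by rewrite mulr_gt0// invr_gt0 exprn_gt0.
exact: cvg_id.
Unshelve. all: by end_near. Qed.

Lemma is_derive_flatexp n t :
  is_derive t (1 : R) (flatexp n) (- n%:R * flatexp n.+1 t + flatexp n.+2 t).
Proof.
have [t0|t0|<-] := ltgtP 0 t; last first.
  have H : h^-1 *: ((flatexp n \o shift 0) (h *: (1 : R)) - flatexp n 0) @[h --> 0^']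
      --> (0 : R).
    under eq_fun => h do
      rewrite flatexp_at0 subr0/= addr0 [_%:A]mulr1 [_ *: _]flatexp_scaleV.
    exact: cvg_within_filter (cvg_flatexp n.+1).
  rewrite !flatexp_at0 mulr0 addr0; apply: DeriveDef; first by apply/cvg_ex; exists 0.
  exact/cvg_lim.
- rewrite /flatexp ltNge (ltW t0)/= mulr0 addr0.
  apply: (@near_eq_is_derive _ _ _ (cst 0)).
  near=> s; rewrite ltNge ifN// negbK ltW//.
  by near: s; exact: lt_nbhsl.
- have tn0 : t != 0 by rewrite gt_eqF.
  apply: (@near_eq_is_derive R R^o R^o (fun s : R => s^-1 ^+ n * expR (- s^-1))).
  + near=> s; rewrite /flatexp ifT//.
    by near: s; exact: lt_nbhsr.
  + have dV := @is_deriveV R id t 1 1 tn0 (is_derive_id _ _).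
    have dE := @is_derive1_comp R expR (fun s => - s^-1) t _ _
      (is_derive_expR _) (is_deriveN dV).
    have := is_deriveM (is_deriveX n dV) dE.
    rewrite exprfctE => /is_derive_eq; apply.
    rewrite /flatexp t0 -!exprVn; case: n => [|n].
      by rewrite /GRing.scale/= ?fctE ?expr0; ring.
    by rewrite /GRing.scale/= ?fctE ?exprS; ring.
Unshelve. all: by end_near.
Qed.
End flatexp.

(** Both difference quotients are the same function of h; along the line, the one-variable chain
    rule applies. *)
Lemma is_derive_line (R : realType) (V : normedModType R) (f : V -> R) x v df :
  is_derive (0 : R) (1 : R) (fun h : R => f (h *: v + x)) df -> is_derive x v f df.
Proof.
set g := fun h => f _ => -[dg <-].
have E : (fun h : R => h^-1 *: ((f \o shift x) (h *: v) - f x)) =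
         (fun h : R => h^-1 *: ((g \o shift 0) (h *: (1 : R)) - g 0)).
  by apply/funext => h; rewrite /g /= scale0r add0r addr0 [_%:A]mulr1.
by apply: DeriveDef; rewrite /derivable /derive E.
Qed.

(** * A class of smooth functions containing the bumps *)

Section smooth.
Context {R : realType} {d : nat}.

(* Closed under partial derivatives, hence a subclass of all the Cn n. *)
Inductive smooth : ('rV[R]_d -> R) -> Prop :=
| smooth_cst c : smooth (cst c)
| smooth_flatexp n i a b : smooth (fun x => flatexp n (a * x ord0 i + b))
| smoothD f g : smooth f -> smooth g -> smooth (f + g)
| smoothM f g : smooth f -> smooth g -> smooth (f * g).

Lemma is_derive_flatexp_coord n i j a b (x : 'rV[R]_d) :
  is_derive x (delta_mx ord0 j) (fun x => flatexp n (a * x ord0 i + b))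
    ((- n%:R * flatexp n.+1 (a * x ord0 i + b) + flatexp n.+2 (a * x ord0 i + b))
     * (a * (i == j)%:R)).
Proof.
apply: is_derive_line.
have -> : (fun h : R => flatexp n (a * (h *: delta_mx ord0 j + x) ord0 i + b)) =
    flatexp n \o (fun h : R => h *: (a * (i == j)%:R) + (a * x ord0 i + b)).
  apply/funext => h /=; congr flatexp.
  by rewrite !mxE eqxx/= mulrDr addrA mulrCA.
have dl : is_derive (0 : R) (1 : R)
    (fun h : R => h *: (a * (i == j)%:R) + (a * x ord0 i + b)) (a * (i == j)%:R).
  have := is_deriveD (is_deriveZ (a * (i == j)%:R) (is_derive_id (0 : R) (1 : R)))
    (is_derive_cst (a * x ord0 i + b) (0 : R) (1 : R)).
  rewrite addr0 [_%:A]mulr1; congr is_derive.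
  by apply/funext => h; congr (_ + _); exact: mulrC.
apply: is_derive1_comp.
by rewrite scale0r add0r; exact: is_derive_flatexp.
Qed.

(** Partial derivatives stay in the class, by [is_derive_flatexp] for the generators and by the sum
    and product rules otherwise; this drives the induction on the order in [smooth_Cn]. *)
Lemma smoothP phi : smooth phi -> continuous phi /\
  forall i, (forall x, derivable phi x (delta_mx ord0 i)) /\
            smooth (partial i phi).
Proof.
elim=> {phi} [c|n i a b|f g _ [cf df] _ [cg dg]|f g sf [cf df] sg [cg dg]].
- split=> [|i]; first exact: cst_continuous.
  split=> [x|]; first exact: derivable_cst.
  suff -> : partial i (cst c) = cst 0 by exact: smooth_cst.
  by apply/funext => x; rewrite /partial derive_cst.
- split=> [x|j].
    apply: (@continuous_comp _ _ _ (fun x : 'rV[R]_d => a * x ord0 i + b) (flatexp n)).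
      apply: continuousD; last exact: cst_continuous.
      by apply: continuousM; [exact: cst_continuous|exact: coord_continuous].
    apply: differentiable_continuous; apply/derivable1_diffP.
    by have [] := is_derive_flatexp n (a * x ord0 i + b).
  split=> [x|]; first by have [] := is_derive_flatexp_coord n i j a b x.
  suff -> : partial j (fun x => flatexp n (a * x ord0 i + b)) =
     (cst (- n%:R) * (fun x => flatexp n.+1 (a * x ord0 i + b)) +
      (fun x => flatexp n.+2 (a * x ord0 i + b))) * cst (a * (i == j)%:R).
    apply: smoothM; last exact: smooth_cst.
    apply: smoothD; last exact: smooth_flatexp.
    by apply: smoothM; [exact: smooth_cst|exact: smooth_flatexp].
  apply/funext => x; rewrite /partial.
  by rewrite (@derive_val _ _ _ _ _ _ _ (is_derive_flatexp_coord n i j a b x)).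
- split=> [x|i]; first by apply: continuousD; [exact: cf|exact: cg].
  split=> [x|]; first by apply: derivableD; [exact: (df i).1|exact: (dg i).1].
  suff -> : partial i (f + g) = partial i f + partial i g.
    by apply: smoothD; [exact: (df i).2|exact: (dg i).2].
  by apply/funext => x; rewrite /partial deriveD; [|exact: (df i).1|exact: (dg i).1].
- split=> [x|i]; first by apply: continuousM; [exact: cf|exact: cg].
  split=> [x|]; first by apply: derivableM; [exact: (df i).1|exact: (dg i).1].
  suff -> : partial i (f * g) = f * partial i g + g * partial i f.
    by apply: smoothD; apply: smoothM => //; [exact: (dg i).2|exact: (df i).2].
  by apply/funext => x; rewrite /partial deriveM; [|exact: (df i).1|exact: (dg i).1].
Qed.

Lemma smooth_Cn n phi : smooth phi -> Cn n phi.
Proof.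
elim: n phi => [|n IH] phi /smoothP[cphi dphi] //=; split=> // i.
by split; [exact: (dphi i).1|apply: IH; exact: (dphi i).2].
Qed.

Lemma smooth_prod n (f : 'I_n -> 'rV[R]_d -> R) :
  (forall i, smooth (f i)) -> smooth (fun x => \prod_(i < n) f i x).
Proof.
elim: n f => [|n IH] f sf.
  by under eq_fun do rewrite big_ord0; exact: smooth_cst.
under eq_fun do rewrite big_ord_recl.
by apply: (@smoothM (f ord0)) => //; exact: IH.
Qed.

End smooth.

(** * Boxes, open sets and measurability in R^d *)

Section boxes.
Context {R : realType} {d : nat}.
Implicit Types (a b x : 'rV[R]_d) (Om : set 'rV[R]_d).
Local Notation mu := (lebesgue_rV R d).

Definition obox a b :=
  [set x : 'rV[R]_d | forall i, a ord0 i < x ord0 i < b ord0 i].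

Definition cbox a b :=
  [set x : 'rV[R]_d | forall i, a ord0 i <= x ord0 i <= b ord0 i].

Lemma measurable_forall_coord (A : 'I_d -> set (measurableTypeR R)) :
  (forall i, measurable (A i)) ->
  measurable [set x : 'rV[R]_d | forall i, A i (x ord0 i)].
Proof.
move=> mA; rewrite (_ : mkset _ =
    \bigcap_(i in [set: 'I_d]) [set x : 'rV[R]_d | A i (x ord0 i)]); last first.
  by apply/seteqP; split => x /= Ax i; [move=> _|]; exact: Ax.
apply: fin_bigcap_measurable => // i _.
by rewrite -[X in measurable X]setTI; exact: measurable_coord.
Qed.

Lemma obox_setE a b : obox a b =
  [set x : 'rV[R]_d | forall i, `]a ord0 i, b ord0 i[%classic (x ord0 i)].
Proof. by apply/seteqP; split => x /= H i; have := H i; rewrite /= in_itv. Qed.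

Lemma cbox_setE a b : cbox a b =
  [set x : 'rV[R]_d | forall i, `[a ord0 i, b ord0 i]%classic (x ord0 i)].
Proof. by apply/seteqP; split => x /= H i; have := H i; rewrite /= in_itv. Qed.

Lemma measurable_obox a b : measurable (obox a b).
Proof.
rewrite obox_setE.
apply: (measurable_forall_coord (A := fun i => `]a ord0 i, b ord0 i[%classic)) => i.
exact: measurable_itv.
Qed.

Lemma measurable_cbox a b : measurable (cbox a b).
Proof.
rewrite cbox_setE.
apply: (measurable_forall_coord (A := fun i => `[a ord0 i, b ord0 i]%classic)) => i.
exact: measurable_itv.
Qed.

Lemma closed_cbox a b : closed (cbox a b).
Proof.
rewrite cbox_setE (_ : mkset _ = \bigcap_(i in [set: 'I_d])
    ((fun x : 'rV[R]_d => x ord0 i) @^-1` `[a ord0 i, b ord0 i])); last first.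
  by apply/seteqP; split => x /= Ax i; [move=> _|]; exact: Ax.
apply: closed_bigI => i _; apply: preimage_closed; last exact: itv_closed.
by move=> x _; exact: coord_continuous.
Qed.

Lemma le_coord_norm (x : 'rV[R]_d) i : `|x ord0 i| <= `|x|.
Proof.
rewrite [leRHS]/Num.Def.normr /= mx_normrE.
by apply/bigmax_geP; right => /=; exists (ord0, i).
Qed.

Lemma compact_cbox a b : compact (cbox a b).
Proof.
apply: bounded_closed_compact; last exact: closed_cbox.
exists (`|a| + `|b|); split; first exact: num_real.
move=> M /ltW abM x axb; apply: le_trans abM.
rewrite [leLHS]/Num.Def.normr /= mx_normrE; apply/bigmax_leP; split => [|[i j] _ /=].
  by rewrite addr_ge0.
rewrite ord1; have /andP[ax xb] := axb j.
rewrite ler_norml; have := le_coord_norm a j; have := le_coord_norm b j.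
have := normr_ge0 a; have := normr_ge0 b.
rewrite !ler_norml => b0 a0 /andP[b1 b2] /andP[a1 a2].
by apply/andP; split; lra.
Qed.

(** Rational corners leave countably many boxes, and the closed box inside [Om] makes room for the
    supports of the bumps. *)
Lemma open_obox_nbhs Om x : open Om -> Om x ->
  exists q : 'rV[rat]_d * 'rV[rat]_d,
    obox (map_mx ratr q.1) (map_mx ratr q.2) x /\
    cbox (map_mx ratr q.1) (map_mx ratr q.2) `<=` Om.
Proof.
move=> oOm Omx; have /nbhs_ballP[e /= e0 eOm] : nbhs x Om by exact: open_nbhs_nbhs.
have Ha i : exists q : rat, ratr q \in `]x ord0 i - e, x ord0 i[.
  by apply: rat_in_itvoo; rewrite ltrBlDr ltrDl.
have Hb i : exists q : rat, ratr q \in `]x ord0 i, x ord0 i + e[.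
  by apply: rat_in_itvoo; rewrite ltrDl.
have /choice[qa qaP] := Ha; have /choice[qb qbP] := Hb.
exists (\row_i qa i, \row_i qb i); split => /= [i|z axb].
  rewrite !mxE; have := qaP i; have := qbP i; rewrite !in_itv/=.
  by move=> /andP[-> _] /andP[_ ->].
(* A ball of the sup norm is itself a box, so it suffices to bound each coordinate. *)
apply: eOm; split=> // i j; rewrite !ord1.
have := axb j; rewrite !mxE; have := qaP j; have := qbP j; rewrite !in_itv/=.
move=> /andP[b1 b2] /andP[a1 a2] /andP[z1 z2].
by rewrite /ball/= ltr_norml; apply/andP; split; lra.
Qed.

Lemma open_bigcup_obox Om : open Om ->
  exists (D : set nat) (a b : nat -> 'rV[R]_d),
    (forall n, D n -> cbox (a n) (b n) `<=` Om) /\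
    Om = \bigcup_(n in D) obox (a n) (b n).
Proof.
move=> oOm.
(* The default for an n that codes no pair is harmless: the index set below keeps only boxes whose
   closed version lies in [Om]. *)
pose q n : 'rV[rat]_d * 'rV[rat]_d := odflt (0, 0) (unpickle n).
pose a n : 'rV[R]_d := map_mx ratr (q n).1.
pose b n : 'rV[R]_d := map_mx ratr (q n).2.
exists [set n | cbox (a n) (b n) `<=` Om], a, b; split => //.
apply/seteqP; split => x => [Omx|[n /= H xn]].
  have [r [xr rOm]] := open_obox_nbhs oOm Omx.
  by exists (pickle r); rewrite /= /a /b /q pickleK.
by apply: H => i; have /andP[/ltW -> /ltW ->] := xn i.
Qed.

(** The sigma-algebra is generated by the coordinates, not by the open sets; the countable union of
    boxes links the two. *)
Lemma open_measurable_rV Om : open Om -> measurable Om.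
Proof.
move=> /open_bigcup_obox[D [a [b [_ ->]]]].
by apply: bigcup_measurable => n _; exact: measurable_obox.
Qed.

Lemma continuous_measurable_rV (f : 'rV[R]_d -> R) :
  continuous f -> measurable_fun setT f.
Proof.
move=> /continuousP cf; apply: (measurability _ (RGenOInfty.measurableE R)).
move=> _ [_ [x ->] <-]; rewrite setTI.
by apply: open_measurable_rV; apply: cf; exact: interval_open.
Qed.

Lemma lebesgue_rV_bounded Om : measurable Om -> bounded_set Om -> (mu Om < +oo)%E.
Proof.
move=> mOm [M [_ MOm]].
(* [bounded_set] bounds the norm only by numbers strictly above M, whence M + 1. *)
pose a : 'rV[R]_d := const_mx (- (M + 1)); pose b : 'rV[R]_d := const_mx (M + 1).
have OmB : Om `<=` cbox a b.
  move=> x Omx i; rewrite !mxE -ler_norml.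
  by rewrite (le_trans (le_coord_norm x i))// MOm// ltrDl.
apply: (@le_lt_trans _ _ (mu (cbox a b))).
  by apply: le_measure => //; rewrite inE//; exact: measurable_cbox.
rewrite cbox_setE (lebesgue_rV_box (A := fun i => `[a ord0 i, b ord0 i]%classic));
  last by move=> i; exact: measurable_itv.
suff : (0 <= \prod_(i < d) lebesgue_measure `[a ord0 i, b ord0 i] < +oo)%E.
  by case/andP.
(* Nonnegativity is carried along because finiteness of a product of extended reals relies on it. *)
elim/big_ind : _ => [|u v /andP[u0 uoo] /andP[v0 voo]|i _].
- by rewrite lee_fin ler01 ltry.
- by rewrite mule_ge0// lte_mul_pinfty// ge0_fin_numE.
- rewrite lebesgue_measure_itv/= !mxE lte_fin; case: ifPn => h; last by rewrite lexx ltry.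
  by rewrite -EFinB ltry lee_fin subr_ge0 ltW.
Qed.

End boxes.

(** * Square-integrable functions on a set of finite measure *)

Section L2.
Context {R : realType} {d : nat}.
Variable Om : set 'rV[R]_d.
Hypothesis mOm : measurable Om.
Local Notation mu := (lebesgue_rV R d).

Lemma L2_lin a u v : L2 Om u -> L2 Om v -> L2 Om (fun x => a * u x + v x).
Proof.
move=> Lu Lv; rewrite /L2.
have -> : (fun x => a * u x + v x) \_ Om = a *: (u \_ Om) + (v \_ Om).
  apply/funext => x; rewrite !fctE /GRing.scale/= !patchE; case: ifP => _ //.
  by rewrite mulr0 addr0.
exact: (@Lfun_submod_closed _ _ _ mu 2%:E (lee1n 2)).2.
Qed.

Lemma L2_cst0 : L2 Om (fun=> 0).
Proof.
rewrite /L2.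
have -> : (fun=> 0) \_ Om = 0 :> ('rV[R]_d -> R).
  by apply/funext => x; rewrite patchE; case: ifP.
exact: (@Lfun_submod_closed _ _ _ mu 2%:E (lee1n 2)).1.
Qed.

Lemma L2_mul_integrable u v : L2 Om u -> L2 Om v ->
  mu.-integrable Om (EFin \o (fun x => u x * v x)).
Proof.
move=> Lu Lv; apply/(integrable_mkcond _ mOm); rewrite restrict_EFin.
have /Lfun1_integrable := Lfun2_mul_Lfun1 Lu Lv.
congr (_.-integrable _ _); apply/funext => x /=; rewrite !patchE; case: ifP => // _.
by rewrite mulr0.
Qed.

Hypothesis fOm : (mu Om < +oo)%E.

Lemma L2_bounded (C : R) (u : 'rV[R]_d -> R) : measurable_fun Om u ->
  (forall x, Om x -> `|u x| <= C) -> L2 Om u.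
Proof.
move=> mu_ uC; rewrite /L2; apply/andP; split; rewrite inE/=.
  by apply/(measurable_restrictT _ mOm).
rewrite /finite_norm unlock /Lnorm poweR_lty//.
apply: (@le_lt_trans _ _ (\int[mu]_(x in Om) (C ^+ 2)%:E)%E); last first.
  by rewrite integral_cst//= lte_mul_pinfty// ?lee_fin ?sqr_ge0.
rewrite [leRHS]integral_mkcond; apply: ge0_le_integral => //.
- by move=> x _; rewrite lee_fin powR_ge0.
- apply/measurable_EFinP; apply: (measurableT_comp (measurable_powR _)) => //.
  by apply: measurableT_comp => //; apply/(measurable_restrictT _ mOm).
- by apply/(measurable_restrictT _ mOm); exact: measurable_cst.
- move=> x _; rewrite /= !patchE; case: ifPn => [/set_mem Omx|_].
    rewrite powR_mulrn// lee_fin.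
    by apply: lerXn2r; rewrite ?nnegrE ?uC// (le_trans (normr_ge0 _) (uC _ Omx)).
  by rewrite normr0 powR0.
Qed.

(** Finite measure puts the constant 1 in L2, and products of L2 functions are integrable. *)
Lemma L2_integrable u : L2 Om u -> mu.-integrable Om (EFin \o u).
Proof.
move=> Lu; have L1 : L2 Om (fun=> 1).
  by apply: (@L2_bounded 1) => // x _; rewrite normr1.
have := L2_mul_integrable Lu L1.
by congr (_.-integrable _ _); apply/funext => x /=; rewrite mulr1.
Qed.

End L2.

(** * Smooth bumps converging to the indicator function of a box *)

Section box_bump.
Context {R : realType} {d : nat}.
Implicit Types (a b x : 'rV[R]_d) (Om : set 'rV[R]_d).

(* flatexp 0 (m * s) tends to 1 as m grows if 0 < s, and is 0 if s <= 0. *)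
Definition box_bump a b n x : R := \prod_(i < d)
  (flatexp 0 (n.+1%:R * x ord0 i + n.+1%:R * - a ord0 i) *
   flatexp 0 (- n.+1%:R * x ord0 i + n.+1%:R * b ord0 i)).

Lemma box_bump_ge0 a b n x : 0 <= box_bump a b n x.
Proof. by apply: prodr_ge0 => i _; rewrite mulr_ge0// flatexp0_ge0. Qed.

Lemma box_bump_le1 a b n x : box_bump a b n x <= 1.
Proof.
apply: prodr_ile1 => i _; rewrite mulr_ge0 ?flatexp0_ge0//=.
by rewrite mulr_ile1 ?flatexp0_ge0 ?flatexp0_le1.
Qed.

Lemma box_bump_out a b n x : ~ obox a b x -> box_bump a b n x = 0.
Proof.
move=> /existsNP[i /negP]; rewrite negb_and -!leNgt => xab.
rewrite /box_bump (bigD1 i)//=.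
suff -> : flatexp 0 (n.+1%:R * x ord0 i + n.+1%:R * - a ord0 i) *
    flatexp 0 (- n.+1%:R * x ord0 i + n.+1%:R * b ord0 i) = 0 by rewrite mul0r.
rewrite /flatexp -mulrDr pmulr_rgt0// subr_gt0 mulNr -mulrN -mulrDr pmulr_rgt0//.
rewrite [- _ + _]addrC subr_gt0.
by case/orP: xab => /le_gtF ->; rewrite ?mul0r ?mulr0.
Qed.

Lemma cvg_prod_ord (u : 'I_d -> nat -> R) (l : 'I_d -> R) :
  (forall i, u i n @[n --> \oo] --> l i) ->
  \prod_(i < d) u i n @[n --> \oo] --> \prod_(i < d) l i.
Proof.
elim: d u l => [|m IH] u l ul.
  by under eq_fun do rewrite big_ord0; rewrite big_ord0; exact: cvg_cst.
under eq_fun do rewrite big_ord_recl.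
by rewrite big_ord_recl; apply: cvgM; [exact: ul|apply: IH => i; exact: ul].
Qed.

Lemma cvg_flatexp0_scale (c : R) : 0 < c ->
  flatexp 0 (n.+1%:R * c) @[n --> \oo] --> (1 : R).
Proof.
move=> c0; have -> : (fun n => flatexp 0 (n.+1%:R * c)) =
    (fun n => expR (- (c^-1 * harmonic n))).
  by apply/funext => n; rewrite /flatexp pmulr_rgt0// c0 expr0 mul1r invfM mulrC.
rewrite -expR0; apply: continuous_cvg; first exact: continuous_expR.
rewrite -oppr0 -(mulr0 c^-1); apply: cvgN; apply: cvgM; first exact: cvg_cst.
exact: cvg_harmonic.
Qed.

Lemma box_bump_cvg a b x : obox a b x -> box_bump a b n x @[n --> \oo] --> (1 : R).
Proof.
move=> xab; have -> : 1 = \prod_(i < d) (1 * 1) :> R by rewrite mulr1 big1.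
apply: cvg_prod_ord => i; have /andP[ax xb] := xab i.
apply: cvgM.
  under eq_fun do rewrite -mulrDr.
  by apply: cvg_flatexp0_scale; rewrite subr_gt0.
under eq_fun do rewrite mulNr -mulrN -mulrDr addrC.
by apply: cvg_flatexp0_scale; rewrite subr_gt0.
Qed.

Lemma smooth_box_bump a b n : smooth (box_bump a b n).
Proof.
apply: smooth_prod => i; exact: smoothM (smooth_flatexp _ _ _ _) (smooth_flatexp _ _ _ _).
Qed.

(** The support, a closure, is only known to lie in the closed box, whence the inclusion asked of
    [cbox]. *)
Lemma test_box_bump Om a b n : cbox a b `<=` Om -> test_function Om (box_bump a b n).
Proof.
move=> abOm; have supp : closure [set x | box_bump a b n x != 0] `<=` cbox a b.
  rewrite [X in _ `<=` X](closure_id _).1; last exact: closed_cbox.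
  apply: closure_subset => x /= xn0; have [xab i|/box_bump_out E] := pselect (obox a b x).
    by have /andP[/ltW -> /ltW ->] := xab i.
  by rewrite E eqxx in xn0.
split; [by move=> m; exact/smooth_Cn/smooth_box_bump| |exact: subset_trans supp abOm].
by apply: subclosed_compact supp; [exact: closed_closure|exact: compact_cbox].
Qed.

End box_bump.

(** * A pi-system generating the sigma-algebra of R^d *)

Section orthants.
Context {R : realType} {d : nat}.

(** Chosen because an orthant meets an open box in an open box again. *)
Definition orthants : set (set 'rV[R]_d) :=
  [set A | exists c : 'rV[R]_d, A = [set x : 'rV[R]_d | forall i, c ord0 i < x ord0 i]].

Lemma orthants_setI : setI_closed orthants.
Proof.
move=> _ _ [a ->] [b ->]; exists (\row_i Num.max (a ord0 i) (b ord0 i)).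
apply/seteqP; split => x /= => [[ax bx] i|abx]; first by rewrite mxE gt_max ax bx.
by split => i; have := abx i; rewrite mxE gt_max => /andP[].
Qed.

Lemma measurable_orthantsE :
  (@measurable _ 'rV[R]_d : set (set 'rV[R]_d)) = <<s orthants >>.
Proof.
apply/seteqP; split; last first.
  apply: smallest_sub; first exact: sigma_algebra_measurable.
  move=> _ [c ->].
  apply: (measurable_forall_coord (A := fun i => [set y | c ord0 i < y])) => i.
  by rewrite -set_itvoy; exact: measurable_itv.
pose T := g_sigma_algebraType orthants.
have mcoord i : measurable_fun [set: T]
    (fun x : T => (x : 'rV[R]_d) ord0 i : measurableTypeR R).
  apply: (measurability _ (RGenOInfty.measurableE R)) => _ [_ [c ->] <-].
  rewrite setTI (_ : _ @^-1` _ = \bigcup_n [set x : 'rV[R]_d |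
      forall j, (if j == i then c else - n%:R) < x ord0 j]).
    apply: bigcup_measurable => n _; apply: sub_sigma_algebra.
    exists (\row_j (if j == i then c else - n%:R)).
    by apply/seteqP; split => x /= H j; have := H j; rewrite mxE.
  apply/seteqP; split => x /=; rewrite in_itv/= andbT.
    move=> cx; exists (Num.truncn `|x|).+1 => // j; case: eqP => [->//|_].
    rewrite ltrNl (le_lt_trans (ler_norm _))// normrN.
    by rewrite (le_lt_trans (le_coord_norm _ _))// truncnS_gt.
  by move=> [n _ /(_ i)]; rewrite eqxx.
apply: smallest_sub; first exact: smallest_sigma_algebra.
rewrite -bigcup_seq => A [i _ [B mB <-]] /=.
exact: mcoord measurableT _ mB.
Qed.

End orthants.

(** * The fundamental lemma of the calculus of variations *)

Section fundamental_lemma.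
Context {R : realType} {d : nat}.
Variables (Om : set 'rV[R]_d) (g : 'rV[R]_d -> R).
Local Notation mu := (lebesgue_rV R d).
Hypothesis oOm : open Om.
Hypothesis ig : mu.-integrable Om (EFin \o g).
Hypothesis g_test : forall phi, test_function Om phi ->
  \int[mu]_(x in Om) (g x * phi x) = 0.

Let mOm : measurable Om. Proof. exact: open_measurable_rV. Qed.

Let mg : measurable_fun Om g.
Proof. by apply/measurable_EFinP; exact: measurable_int ig. Qed.

(** Dominated convergence: g times the bumps has integral 0, is dominated by |g| and tends to g
    restricted to the box. *)
Lemma integral_obox_eq0 a b : cbox a b `<=` Om ->
  (\int[mu]_(x in obox a b) (g x)%:E = 0)%E.
Proof.
move=> abOm; have oboxOm : obox a b `<=` Om.
  by move=> x xab; apply: abOm => i; have /andP[/ltW -> /ltW ->] := xab i.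
have mf n : measurable_fun Om (fun x => (g x * box_bump a b n x)%:E).
  apply/measurable_EFinP/measurable_funM => //.
  apply: measurable_funTS; apply: continuous_measurable_rV.
  exact: (smoothP (smooth_box_bump _ _ _)).1.
have dom n x : Om x -> (`|(g x * box_bump a b n x)%:E| <= `|(g x)%:E|)%E.
  move=> _; rewrite !abse_EFin lee_fin normrM ler_piMr//.
  by rewrite ger0_norm ?box_bump_ge0 ?box_bump_le1.
have int0 n : (\int[mu]_(x in Om) (g x * box_bump a b n x)%:E = 0)%E.
  have ifn : mu.-integrable Om (fun x => (g x * box_bump a b n x)%:E).
    by apply: (le_integrable mOm (mf n) (dom n) ig).
  (* [g_test] speaks of the real-valued integral, which is also 0 for an infinite one; finiteness is
     needed to come back. *)
  rewrite -[LHS]fineK; last exact: integrable_fin_num.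
  by congr EFin; apply: g_test; exact: test_box_bump.
have [||||_ _] := @dominated_convergence _ _ _ mu Om mOm
    (fun n x => (g x * box_bump a b n x)%:E)
    ((EFin \o g) \_ (obox a b)) (fun x => `|(g x)%:E|%E) mf.
- apply/(measurable_restrict _ (measurable_obox a b) mOm).
  by apply: measurable_funS mOm _ (measurable_int _ ig); exact: subIsetl.
- apply: aeW => x Omx; rewrite patchE; case: ifPn => [/set_mem xab|/negP xab].
    apply: cvg_EFin; first by apply: nearW.
    rewrite -[X in _ --> X]mulr1; apply: cvgM; first exact: cvg_cst.
    exact: box_bump_cvg.
  have -> : (fun n => (g x * box_bump a b n x)%:E) = cst 0%E.
    by apply/funext => n; rewrite box_bump_out ?mulr0// => /mem_set.
  exact: cvg_cst.
- exact: integrable_abse.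
- by apply: aeW => x n; exact: dom.
under eq_fun do rewrite int0.
rewrite -integral_mkcondr setIidr// => /cvg_lim <-//.
by rewrite lim_cst.
Qed.

(** Intersecting with a fixed box inside [Om] keeps g integrable throughout the Dynkin induction,
    and the case of the whole space is the previous lemma. *)
Lemma integral_setI_obox_eq0 a b A : cbox a b `<=` Om -> measurable A ->
  (\int[mu]_(x in A `&` obox a b) (g x)%:E = 0)%E.
Proof.
move=> abOm; rewrite measurable_orthantsE; move: A.
have mB := measurable_obox a b.
have iB : mu.-integrable (obox a b) (EFin \o g).
  apply: integrableS ig => // x xab; apply: abOm => i.
  by have /andP[/ltW -> /ltW ->] := xab i.
apply: (@dynkin_induction _ _ orthants
  (fun A => \int[mu]_(x in A `&` obox a b) (g x)%:E = 0)%E).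
- exact: measurable_orthantsE.
- exact: orthants_setI.
- by rewrite setTI; exact: integral_obox_eq0.
- move=> _ [c ->] /=.
  (* Raising the lower corner only shrinks the closed box, which thus stays in [Om]. *)
  rewrite (_ : _ `&` _ = obox (\row_i Num.max (c ord0 i) (a ord0 i)) b).
    apply: integral_obox_eq0; apply: subset_trans abOm => x cx i.
    by have := cx i; rewrite mxE ge_max -andbA => /and3P[_ -> ->].
  apply/seteqP; split => x /= => [[cx ax] i|cax].
    by rewrite mxE gt_max cx; exact: ax.
  by split => i; have := cax i; rewrite mxE gt_max => /andP[/andP[? ?] ?] //; apply/andP.
(* For a complement, subtract from the integral over the whole box, which vanishes. *)
- move=> S mS S0; have := integral_obox_eq0 abOm.
  rewrite -{1}[obox a b]setTI -(setUv S) setIUl integral_setU_EFin//.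
  + by rewrite S0 add0e.
  + exact: measurableI.
  + by apply: measurableI => //; exact: measurableC.
  + by rewrite -setIUl setUv setTI; apply/measurable_EFinP; exact: measurable_int iB.
  + by apply/disj_setPS => x [[Sx _] [nSx _]].
- move=> F mF tF F0; rewrite setI_bigcupl integral_bigcup.
  + by rewrite eseries0.
  + by apply: trivIset_setIr.
  + by move=> k; exact: measurableI.
  + apply: integrableS iB => //.
      by apply: bigcup_measurable => k _; exact: measurableI.
    by move=> x [k _ []].
Qed.

(** On each box g has zero integral over every measurable subset, hence vanishes almost everywhere;
    countably many boxes cover [Om]. *)
Lemma test_orthogonal_ae_eq0 : {ae mu, forall x, Om x -> g x = 0}.
Proof.
have [D [a [b [abOm OmE]]]] := open_bigcup_obox oOm.
have ae0 n : D n -> {ae mu, forall x, obox (a n) (b n) x -> g x = 0}.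
  move=> Dn; have mB := measurable_obox (a n) (b n).
  have iB : mu.-integrable (obox (a n) (b n)) (EFin \o g).
    by apply: integrableS ig => // x xB; rewrite OmE; exists n.
  have : ae_eq mu (obox (a n) (b n)) (EFin \o g) (cst 0%E).
    apply: integral_ae_eq => // E EB mE.
    rewrite integral_cst// mul0e -(setIidl EB).
    exact: integral_setI_obox_eq0 (abOm _ Dn) mE.
  by apply: filterS => x H Bx; have [] := H Bx.
have : {ae mu, forall x n, D n -> obox (a n) (b n) x -> g x = 0}.
  apply/ae_foralln => n; have [Dn|nDn] := pselect (D n).
    by apply: filterS (ae0 n Dn) => x H _.
  by apply: aeW => x /nDn.
by apply: filterS => x H; rewrite {1}OmE => -[n Dn Bx]; exact: H n Dn Bx.
Qed.

End fundamental_lemma.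

(** * Integrability of test functions and of their derivatives *)

Section test_functions.
Context {R : realType} {d : nat}.
Variable Om : set 'rV[R]_d.
Hypothesis mOm : measurable Om.
Hypothesis fOm : (lebesgue_rV R d Om < +oo)%E.

Lemma L2_compact_support (K : set 'rV[R]_d) (f : 'rV[R]_d -> R) :
  compact K -> continuous f -> (forall x, ~ K x -> f x = 0) -> L2 Om f.
Proof.
move=> cK cf f0.
have [C [_ HC]] : bounded_set (f @` K).
  by apply/compact_bounded/continuous_compact => //; exact: continuous_subspaceT.
(* The maximum with 0 serves the points outside K, since C may be negative when K is empty. *)
apply: (@L2_bounded _ _ Om mOm fOm (Num.max 0 (C + 1))).
  by apply: measurable_funTS; exact: continuous_measurable_rV.
move=> x _; rewrite le_max; have [Kx|/f0 ->] := pselect (K x); last first.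
  by rewrite normr0 lexx.
by apply/orP; right; apply: HC; [rewrite ltrDl|exists x].
Qed.

Lemma test_function_L2 phi : test_function Om phi -> L2 Om phi.
Proof.
move=> [sphi cphi _]; apply: L2_compact_support cphi (sphi 0%N) _ => x.
by apply: contra_notP => /eqP fx; exact: subset_closure.
Qed.

(** Off the closed support, phi vanishes in a neighbourhood, so its derivative vanishes there and
    has the same compact support to rely on. *)
Lemma partial_test_function_L2 i phi :
  test_function Om phi -> L2 Om (partial i phi).
Proof.
move=> [sphi cphi _]; have [_ /(_ i)[_ cdphi]] := sphi 1%N.
apply: L2_compact_support cphi cdphi _ => x Kx.
rewrite /partial (@near_eq_derive _ _ _ phi (cst 0)) ?derive_cst//.
have : nbhs x (~` closure [set x | phi x != 0]).
  by apply: open_nbhs_nbhs; split => //; exact/closed_openC/closed_closure.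
apply: filterS => z Kz; apply/eqP; apply: contra_notT Kz => fz.
exact: subset_closure.
Qed.

End test_functions.

(** * Weak gradients: uniqueness and bilinearity of the inner product *)

Section weak_gradient.
Context {R : realType} {d : nat}.
Variable Om : set 'rV[R]_d.
Local Notation mu := (lebesgue_rV R d).
Hypothesis oOm : open Om.
Hypothesis fOm : (mu Om < +oo)%E.
Implicit Types (u v : 'rV[R]_d -> R) (F G : 'rV[R]_d -> 'rV[R]_d).

Let mOm : measurable Om. Proof. exact: open_measurable_rV. Qed.

Lemma Rintegral_lin a u v : mu.-integrable Om (EFin \o u) ->
    mu.-integrable Om (EFin \o v) ->
  \int[mu]_(x in Om) (a * u x + v x) =
  a * \int[mu]_(x in Om) u x + \int[mu]_(x in Om) v x.
Proof.
move=> iu iv; rewrite RintegralD ?RintegralZl//.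
by have := integrableZl mOm a iu.
Qed.

Lemma weak_grad_unique u F G : is_weak_grad Om u F -> is_weak_grad Om u G ->
  {ae mu, forall x i, Om x -> F x ord0 i = G x ord0 i}.
Proof.
move=> wF wG; suff H i : {ae mu, forall x, Om x -> F x ord0 i = G x ord0 i}.
  by apply: filter_forall.
have [LF HF] := wF i; have [LG HG] := wG i.
(* The difference is written as a * u + v with a = -1, the shape of [L2_lin] and [Rintegral_lin]. *)
have LGF := L2_lin (-1) LG LF.
have : {ae mu, forall x, Om x -> -1 * G x ord0 i + F x ord0 i = 0}.
  apply: test_orthogonal_ae_eq0 => //; first exact: L2_integrable.
  move=> phi tphi; have Lphi := test_function_L2 mOm fOm tphi.
  transitivity (\int[mu]_(x in Om) (-1 * (G x ord0 i * phi x) + F x ord0 i * phi x)).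
    by apply: eq_Rintegral => x _; rewrite mulrDl mulrA.
  rewrite Rintegral_lin; [|exact: L2_mul_integrable..].
  by rewrite mulN1r -HG// HF// addNr.
by apply: filterS => x H Omx; apply/eqP; rewrite -subr_eq0 addrC -mulN1r H.
Qed.

Lemma is_weak_grad_lin a u v F G : L2 Om u -> L2 Om v ->
  is_weak_grad Om u F -> is_weak_grad Om v G ->
  is_weak_grad Om (fun x => a * u x + v x) (fun x => a *: F x + G x).
Proof.
move=> Lu Lv wF wG i; have [LF HF] := wF i; have [LG HG] := wG i.
split=> [|phi tphi].
  by under eq_fun do rewrite !mxE; exact: L2_lin.
have Lphi := test_function_L2 mOm fOm tphi.
have Ldphi := partial_test_function_L2 mOm fOm i tphi.
transitivity (\int[mu]_(x in Om)
    (a * (u x * partial i phi x) + v x * partial i phi x)).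
  by apply: eq_Rintegral => x _; rewrite mulrDl mulrA.
transitivity (- \int[mu]_(x in Om)
    (a * (F x ord0 i * phi x) + G x ord0 i * phi x)); last first.
  by congr (- _); apply: eq_Rintegral => x _; rewrite !mxE mulrDl mulrA.
rewrite !Rintegral_lin; [|exact: L2_mul_integrable..].
by rewrite HF// HG// opprD mulrN.
Qed.

(** Used because the expansions in time hold only for x in the closure of [Om]. *)
Lemma eq_is_weak_grad u v G : {in Om, u =1 v} ->
  is_weak_grad Om u G -> is_weak_grad Om v G.
Proof.
move=> uv wG i; have [LG HG] := wG i; split=> // phi tphi.
by rewrite -HG//; apply: eq_Rintegral => x Omx; rewrite uv.
Qed.

Lemma gradP u G : is_weak_grad Om u G -> is_weak_grad Om u (grad Om u).
Proof. by move=> wG; apply: (@getPex _ [set G | is_weak_grad Om u G]); exists G. Qed.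

Lemma grad_H1 u : H1 Om u -> is_weak_grad Om u (grad Om u).
Proof. by move=> [_ [G /gradP]]. Qed.

Lemma is_weak_grad0 : is_weak_grad Om (fun=> 0) (fun=> 0).
Proof.
move=> i; split=> [|phi _]; first by under eq_fun do rewrite mxE; exact: L2_cst0.
have I0 f : (forall x, f x = 0) -> \int[mu]_(x in Om) f x = 0.
  move=> f0; under eq_Rintegral do rewrite f0.
  by rewrite Rintegral_cst// mul0r.
by rewrite !I0 ?oppr0// => x; rewrite ?mxE mul0r.
Qed.

Lemma H1_sum n (c : 'I_n -> R) (u : 'I_n -> 'rV[R]_d -> R) :
  (forall j, H1 Om (u j)) ->
  L2 Om (fun x => \sum_(j < n) c j * u j x) /\
  is_weak_grad Om (fun x => \sum_(j < n) c j * u j x)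
    (fun x => \sum_(j < n) c j *: grad Om (u j) x).
Proof.
elim: n c u => [|n IH] c u uH.
  under eq_fun do rewrite big_ord0.
  under [X in is_weak_grad _ _ X]eq_fun do rewrite big_ord0.
  by split; [exact: L2_cst0|exact: is_weak_grad0].
under eq_fun do rewrite big_ord_recl.
under [X in is_weak_grad _ _ X]eq_fun do rewrite big_ord_recl.
have [Ls ws] := IH (fun j => c (lift ord0 j)) _ (fun j => uH (lift ord0 j)).
split; first by apply: L2_lin => //; have [] := uH ord0.
by apply: is_weak_grad_lin => //; [have [] := uH ord0|exact: grad_H1].
Qed.

Definition L2_vec F := forall i, L2 Om (fun x => F x ord0 i).

Lemma weak_grad_L2_vec u F : is_weak_grad Om u F -> L2_vec F.
Proof. by move=> wF i; have [] := wF i. Qed.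

Lemma dot_integrable F G : L2_vec F -> L2_vec G ->
  mu.-integrable Om (fun x => (dot (F x) (G x))%:E).
Proof.
move=> LF LG; under eq_fun do rewrite /dot -sumEFin.
apply: integrable_sum => // i _; exact: L2_mul_integrable.
Qed.

Lemma ip_vecC F G : ip_vec Om F G = ip_vec Om G F.
Proof.
by apply: eq_Rintegral => x _; apply: eq_bigr => i _; rewrite mulrC.
Qed.

Lemma ip_vec_lin a F F' G : L2_vec F -> L2_vec F' -> L2_vec G ->
  ip_vec Om (fun x => a *: F x + F' x) G = a * ip_vec Om F G + ip_vec Om F' G.
Proof.
move=> LF LF' LG; rewrite /ip_vec -Rintegral_lin; [|exact: dot_integrable..].
apply: eq_Rintegral => x _; rewrite /dot mulr_sumr -big_split/=.
by apply: eq_bigr => i _; rewrite !mxE mulrDl mulrA.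
Qed.

Lemma ip_vec_suml n (c : 'I_n -> R) (F : 'I_n -> 'rV[R]_d -> 'rV[R]_d) G :
  (forall j, L2_vec (F j)) -> L2_vec G ->
  L2_vec (fun x => \sum_(j < n) c j *: F j x) /\
  ip_vec Om (fun x => \sum_(j < n) c j *: F j x) G =
  \sum_(j < n) c j * ip_vec Om (F j) G.
Proof.
elim: n c F => [|n IH] c F LF LG.
  split => [i|].
    by under eq_fun do rewrite big_ord0 mxE; exact: L2_cst0.
  rewrite big_ord0 -[RHS](mul0r (fine (mu Om))) -Rintegral_cst//.
  apply: eq_Rintegral => x _; rewrite big_ord0 /dot big1// => i _.
  by rewrite mxE mul0r.
under [X in L2_vec X]eq_fun do rewrite big_ord_recl.
under [X in ip_vec _ X]eq_fun do rewrite big_ord_recl.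
have [Ls Es] := IH (fun j => c (lift ord0 j)) _ (fun j => LF (lift ord0 j)) LG.
rewrite big_ord_recl -Es; split; last exact: ip_vec_lin.
by move=> i; under eq_fun do rewrite !mxE; exact: L2_lin (LF _ _) (Ls _).
Qed.

Lemma ip_vec_sum m n (a : 'I_m -> R) (b : 'I_n -> R)
    (F : 'I_m -> 'rV[R]_d -> 'rV[R]_d) (G : 'I_n -> 'rV[R]_d -> 'rV[R]_d) :
  (forall i, L2_vec (F i)) -> (forall j, L2_vec (G j)) ->
  ip_vec Om (fun x => \sum_(i < m) a i *: F i x)
    (fun x => \sum_(j < n) b j *: G j x) =
  \sum_(i < m) \sum_(j < n) a i * b j * ip_vec Om (F i) (G j).
Proof.
move=> LF LG.
have LsG : L2_vec (fun x => \sum_(j < n) b j *: G j x).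
  by have [] := @ip_vec_suml n b G (fun=> 0) LG (weak_grad_L2_vec is_weak_grad0).
rewrite (ip_vec_suml a LF LsG).2; apply: eq_bigr => i _.
rewrite ip_vecC (ip_vec_suml b LG (LF i)).2 mulr_sumr.
by apply: eq_bigr => j _; rewrite mulrA [in RHS]ip_vecC.
Qed.

(** The chosen gradients differ from F and G on a null set only, so any convenient weak gradients,
    such as explicit sums, compute the inner product. *)
Lemma ip_vec_weak_grad u v F G : is_weak_grad Om u F -> is_weak_grad Om v G ->
  ip_vec Om (grad Om u) (grad Om v) = ip_vec Om F G.
Proof.
move=> wF wG; have wu := gradP wF; have wv := gradP wG.
have /integrableP[m1 _] :=
  dot_integrable (weak_grad_L2_vec wu) (weak_grad_L2_vec wv).
have /integrableP[m2 _] :=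
  dot_integrable (weak_grad_L2_vec wF) (weak_grad_L2_vec wG).
rewrite /ip_vec /Rintegral; congr fine.
apply: ae_eq_integral mOm m1 m2 _.
have := weak_grad_unique wu wF; have := weak_grad_unique wv wG.
apply: filterS2 => x Hv Hu Omx; congr EFin; apply: eq_bigr => i _.
by rewrite Hu// Hv.
Qed.

Lemma ip_vecZ a F G : L2_vec F -> L2_vec G ->
  ip_vec Om (fun x => a *: F x) G = a * ip_vec Om F G.
Proof.
move=> LF LG; rewrite /ip_vec -RintegralZl//; last exact: dot_integrable.
apply: eq_Rintegral => x _; rewrite /dot mulr_sumr.
by apply: eq_bigr => i _; rewrite mxE mulrA.
Qed.

Lemma weak_grad_sum n (c : 'I_n -> R) (us : 'I_n -> 'rV[R]_d -> R) u :
  (forall j, H1 Om (us j)) ->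
  (forall x, Om x -> u x = \sum_(j < n) c j * us j x) ->
  is_weak_grad Om u (fun x => \sum_(j < n) c j *: grad Om (us j) x).
Proof.
move=> Hus uE; apply: eq_is_weak_grad (H1_sum c Hus).2 => x Omx.
by rewrite uE//; exact: set_mem.
Qed.

(** Used with powers of t or their derivatives as a and b: all dependence on t then sits in the
    scalar coefficients. *)
Lemma ip_vec_grad_sum m n (a : 'I_m -> R) (b : 'I_n -> R) u v
    (us : 'I_m -> 'rV[R]_d -> R) (vs : 'I_n -> 'rV[R]_d -> R) :
  (forall i, H1 Om (us i)) -> (forall j, H1 Om (vs j)) ->
  (forall x, Om x -> u x = \sum_(i < m) a i * us i x) ->
  (forall x, Om x -> v x = \sum_(j < n) b j * vs j x) ->
  ip_vec Om (grad Om u) (grad Om v) =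
  \sum_(i < m) \sum_(j < n)
    a i * b j * ip_vec Om (grad Om (us i)) (grad Om (vs j)).
Proof.
move=> Hus Hvs uE vE; rewrite -ip_vec_sum.
- by apply: ip_vec_weak_grad; exact: weak_grad_sum.
- by move=> i; exact: weak_grad_L2_vec (grad_H1 (Hus i)).
- by move=> j; exact: weak_grad_L2_vec (grad_H1 (Hvs j)).
Qed.

End weak_gradient.

(** * Functions of time that are polynomial inside an interval *)

Section piecewise_polynomial_integral.
Context {R : realType}.
Local Notation leb := (@lebesgue_measure R).

Lemma integrable_setU_disj dd (T : measurableType dd) (mu : {measure set T -> \bar R})
    (A B : set T) (f : T -> \bar R) : measurable A -> measurable B ->
  [disjoint A & B] -> mu.-integrable A f -> mu.-integrable B f ->
  mu.-integrable (A `|` B) f.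
Proof.
move=> mA mB AB /integrableP[mfA fA] /integrableP[mfB fB].
have mf : measurable_fun (A `|` B) f by apply/measurable_funU.
apply/integrableP; split => //.
rewrite ge0_integral_setU//; first by rewrite lte_add_pinfty.
exact: measurableT_comp.
Qed.

Lemma integrable_horner (P : {poly R}) a b :
  leb.-integrable `[a, b] (EFin \o horner P).
Proof.
apply: continuous_compact_integrable; first exact: segment_compact.
by apply: continuous_subspaceT => x; exact: continuous_horner.
Qed.

Lemma Rintegral_deriv_horner (P : {poly R}) a b : a < b ->
  \int[leb]_(t in `[a, b]) P^`().[t] = P.[b] - P.[a].
Proof.
move=> ab; rewrite /Rintegral (@continuous_FTC2 _ _ (horner P))//.
- by apply: continuous_subspaceT => x; exact: continuous_horner.
- split; first by move=> x _; exact: derivable_horner.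
  + by apply: cvg_at_right_filter; exact: continuous_horner.
  + by apply: cvg_at_left_filter; exact: continuous_horner.
- by move=> x _; rewrite derivE.
Qed.

Section eq_on_open_interval.
Variables (a b : R) (f : R -> R) (P : {poly R}).
Hypothesis fP : {in `]a, b[, f =1 horner P}.

Let mf : measurable_fun `[a, b] f.
Proof.
apply/measurable_fun_itv_bndo_bndcP/measurable_fun_itv_obnd_cbndP.
apply: (eq_measurable_fun (horner P)) => [x /set_mem xab|].
  by rewrite fP.
by apply: measurable_funTS; apply: continuous_measurable_fun; exact: continuous_horner.
Qed.

Let measurable_oo (h : R -> \bar R) :
  measurable_fun `[a, b] h -> measurable_fun `]a, b[ h.
Proof. by apply: measurable_funS => //; exact: subset_itv_oo_cc. Qed.

Lemma integrable_eq_horner : leb.-integrable `[a, b] (EFin \o f).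
Proof.
have mEf : measurable_fun `[a, b] (EFin \o f) by exact/measurable_EFinP.
have /integrableP[mP] := integrable_horner P a b.
rewrite integral_itv_bndoo; last by apply: measurable_oo; exact: measurableT_comp.
move=> Poo; apply/integrableP; split => //.
rewrite integral_itv_bndoo; last by apply: measurable_oo; exact: measurableT_comp.
by under eq_integral => x /set_mem xab do rewrite /= fP//.
Qed.

(** The end points form a null set; nothing is known there about the piecewise derivatives. *)
Lemma Rintegral_eq_horner :
  \int[leb]_(t in `[a, b]) f t = \int[leb]_(t in `[a, b]) P.[t].
Proof.
have /integrableP[mP _] := integrable_horner P a b.
rewrite /Rintegral; congr fine.
rewrite [LHS]integral_itv_bndoo; last first.
  by apply: measurable_oo; exact/measurable_EFinP.
rewrite [RHS]integral_itv_bndoo; last exact: measurable_oo.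
by apply: eq_integral => x /set_mem xab; rewrite fP.
Qed.

(** One-sided limits at the end points are unique; this gives access to the energy at grid
    points. *)
Lemma eq_horner_closed : a < b -> {within `[a, b], continuous f} ->
  {in `[a, b], f =1 horner P}.
Proof.
move=> ab /(continuous_within_itvP _ ab)[_ fa fb] x.
rewrite in_itv/= => /andP[]; rewrite le_eqVlt => /predU1P[<- _|ax].
  apply: (@cvg_unique _ _ (f @ a^'+)) => //.
    have Pa : horner P @ a^'+ --> P.[a].
      by apply: cvg_at_right_filter; exact: continuous_horner.
    apply: cvg_trans Pa; apply: near_eq_cvg; near=> t; rewrite fP// in_itv/=.
    by apply/andP; split; near: t; [exact: nbhs_right_gt|exact: nbhs_right_lt].
rewrite le_eqVlt => /predU1P[->|xb]; last by rewrite fP// in_itv/= ax xb.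
apply: (@cvg_unique _ _ (f @ b^'-)) => //.
  have Pb : horner P @ b^'- --> P.[b].
    by apply: cvg_at_left_filter; exact: continuous_horner.
  apply: cvg_trans Pb; apply: near_eq_cvg; near=> t; rewrite fP// in_itv/=.
  by apply/andP; split; near: t; [exact: nbhs_left_gt|exact: nbhs_left_lt].
Unshelve. all: by end_near. Qed.

Lemma derive1_eq_horner : {in `]a, b[, derive1 f =1 horner P^`()}.
Proof.
move=> x xab; rewrite derive1E (@near_eq_derive _ _ _ f (horner P)).
  by rewrite -derive1E derivE.
have : nbhs x `]a, b[%classic by exact: open_nbhs_nbhs.
by apply: filterS => t tab; rewrite fP.
Qed.

End eq_on_open_interval.
End piecewise_polynomial_integral.

(** * Time derivatives as admissible test functions *)

Section finite_elements_scale.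
Context {R : realType} {d : nat}.
Variables (Om : set 'rV[R]_d) (M : nat) (T : 'I_M -> 'M[R]_(d.+1, d)) (k : nat).
Hypothesis oOm : open Om.
Hypothesis fOm : (lebesgue_rV R d Om < +oo)%E.

Lemma H1_scale a v : H1 Om v -> H1 Om (fun x => a * v x).
Proof.
move=> Hv; have [Lv wv] := @H1_sum _ _ Om oOm fOm 1 (fun=> a) (fun=> v) (fun=> Hv).
have -> : (fun x => a * v x) = (fun x => \sum_(j < 1) a * v x).
  by apply/funext => x; rewrite big_ord1.
by split => //; eexists; exact: wv.
Qed.

Lemma Vh_scale a v : Vh Om T k v -> Vh Om T k (fun x => a * v x).
Proof.
move=> [Hv cv Pv]; split; first exact: H1_scale.
- by move=> x; apply: cvgM; [exact: cvg_cst|exact: cv].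
- move=> i; have [p pk pE] := Pv i.
  exists (a *: p); first exact: leq_trans (mpoly.msizeZ_le _ _) pk.
  by move=> x /pE ->; rewrite mpoly.mevalZ.
Qed.

Lemma deriv_Xn_horner (n : nat) (t : R) : ('X^n)^`().[t] = n%:R * t ^+ n.-1.
Proof. by rewrite derivXn hornerMn hornerXn mulr_natl. Qed.

Lemma Pr_dt N (tau : nat -> R) q (psi : R -> 'rV[R]_d -> R) :
  Pr N tau q.+1 (Vh Om T k) (closure Om) psi ->
  Pr N tau q (Vh Om T k) (closure Om) (dt psi).
Proof.
move=> Ppsi n nN; have [c [Vc cE]] := Ppsi n nN.
(* The constant term drops out and [lift ord0 j] is the index j + 1, so the new coefficient is (j +
   1) c_(j+1). *)
exists (fun (j : 'I_q.+1) x => j.+1%:R * c (lift ord0 j) x).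
split=> [j|t x tn Dx]; first exact: Vh_scale.
have E : {in `]tau n, tau n.+1[, psi^~ x =1
    horner (\sum_(j < q.+2) c j x *: 'X^j)}.
  move=> s; rewrite in_itv/= => sn; rewrite cE// horner_sum.
  by apply: eq_bigr => j _; rewrite hornerZ hornerXn mulrC.
rewrite /dt (derive1_eq_horner E) ?in_itv// linear_sum/= horner_sum big_ord_recl.
rewrite derivZ derivC scaler0 horner0 add0r.
apply: eq_bigr => j _; rewrite derivZ hornerZ deriv_Xn_horner/=.
by rewrite mulrC -mulrA mulrCA.
Qed.

End finite_elements_scale.

(** * The energy identity on one time slab *)

Section slab.
Context {R : realType} {d : nat}.
Variables (Om : set 'rV[R]_d).
Local Notation mu := (lebesgue_rV R d).
Local Notation leb := (@lebesgue_measure R).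
Hypothesis oOm : open Om.
Hypothesis fOm : (mu Om < +oo)%E.
Variables (J : nat) (w : 'I_J -> R) (y : 'I_J -> 'rV[R]_d).
Hypothesis hy : forall j, closure Om (y j).
Variables (alpha beta : R) (a b : R).
Hypothesis ab : a < b.
Variables (q : nat) (c e : 'I_q -> 'rV[R]_d -> R).
Hypothesis Hc : forall j, H1 Om (c j).
Variables (psi p : R -> 'rV[R]_d -> R).
Hypothesis psi_cont :
  forall x : 'rV[R]_d, closure Om x -> {within `[a, b], continuous psi^~ x}.
Hypothesis p_cont :
  forall x : 'rV[R]_d, closure Om x -> {within `[a, b], continuous p^~ x}.
Hypothesis psiE : forall t (x : 'rV[R]_d), a < t < b -> closure Om x ->
  psi t x = \sum_(j < q) t ^+ j * c j x.
Hypothesis pE : forall t (x : 'rV[R]_d), a < t < b -> closure Om x ->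
  p t x = \sum_(j < q) t ^+ j * e j x.

(** A polynomial in t with x as a parameter; in this section [q] counts coefficients and is thus the
    degree bound plus one. *)
Let time_poly (u : 'I_q -> 'rV[R]_d -> R) x : {poly R} := \sum_(j < q) u j x *: 'X^j.

Let time_polyE u x t : (time_poly u x).[t] = \sum_(j < q) t ^+ j * u j x.
Proof.
rewrite horner_sum; apply: eq_bigr => j _.
by rewrite hornerZ hornerXn mulrC.
Qed.

Let dtime_polyE u x t :
  (time_poly u x)^`().[t] = \sum_(j < q) ('X^j)^`().[t] * u j x.
Proof.
rewrite linear_sum/= horner_sum; apply: eq_bigr => j _.
by rewrite derivZ hornerZ mulrC.
Qed.

Let psi_oo x : closure Om x -> {in `]a, b[, psi^~ x =1 horner (time_poly c x)}.
Proof. by move=> Dx t; rewrite in_itv/= => tab; rewrite psiE// time_polyE. Qed.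

Let p_oo x : closure Om x -> {in `]a, b[, p^~ x =1 horner (time_poly e x)}.
Proof. by move=> Dx t; rewrite in_itv/= => tab; rewrite pE// time_polyE. Qed.

Let psi_cc x t : closure Om x -> t \in `[a, b] -> psi t x = (time_poly c x).[t].
Proof. by move=> Dx; exact: (eq_horner_closed (psi_oo Dx) ab (psi_cont Dx)). Qed.

Let p_cc x t : closure Om x -> t \in `[a, b] -> p t x = (time_poly e x).[t].
Proof. by move=> Dx; exact: (eq_horner_closed (p_oo Dx) ab (p_cont Dx)). Qed.

Let dpsi_oo x t : closure Om x -> t \in `]a, b[ ->
  dt psi t x = (time_poly c x)^`().[t].
Proof. by move=> Dx; exact: derive1_eq_horner (psi_oo Dx) t. Qed.

Let dp_oo x t : closure Om x -> t \in `]a, b[ ->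
  dt p t x = (time_poly e x)^`().[t].
Proof. by move=> Dx; exact: derive1_eq_horner (p_oo Dx) t. Qed.

Let A i j := ip_vec Om (grad Om (c i)) (grad Om (c j)).

Let AC i j : A i j = A j i. Proof. exact: ip_vecC. Qed.

(** The bilinear form of the stiffness matrix [A] on vectors of time polynomials; [mono] and [dmono]
    below represent psi and its time derivative. *)
Let stiff (u v : 'I_q -> {poly R}) : {poly R} :=
  \sum_(i < q) \sum_(j < q) A i j *: (u i * v j).

Let stiffE u v t : (stiff u v).[t] =
  \sum_(i < q) \sum_(j < q) (u i).[t] * (v j).[t] * A i j.
Proof.
rewrite horner_sum; apply: eq_bigr => i _; rewrite horner_sum.
by apply: eq_bigr => j _; rewrite hornerZ hornerM mulrC.
Qed.

Let stiffC u v : stiff u v = stiff v u.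
Proof.
rewrite /stiff exchange_big/=; apply: eq_bigr => i _; apply: eq_bigr => j _.
by rewrite AC mulrC.
Qed.

Let mono (j : 'I_q) : {poly R} := 'X^j.
Let dmono (j : 'I_q) : {poly R} := ('X^j)^`().

Let deriv_stiff : (stiff mono mono)^`() = 2 *: stiff mono dmono.
Proof.
have -> : (stiff mono mono)^`() = stiff dmono mono + stiff mono dmono.
  rewrite /stiff linear_sum/= -big_split/=; apply: eq_bigr => i _.
  rewrite linear_sum/= -big_split/=; apply: eq_bigr => j _.
  by rewrite derivZ derivM scalerDr.
by rewrite stiffC scaler_nat mulr2n.
Qed.

(** On the closed interval, unlike the next two, because the energy is evaluated at a and b. *)
Let grad_psi t : t \in `[a, b] ->
  ip_vec Om (grad Om (psi t)) (grad Om (psi t)) = (stiff mono mono).[t].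
Proof.
move=> tab; rewrite stiffE.
apply: ip_vec_grad_sum => // x /subset_closure Dx; rewrite psi_cc// time_polyE;
by apply: eq_bigr => j _; rewrite hornerXn.
Qed.

Let grad_dpsi t : t \in `]a, b[ ->
  ip_vec Om (grad Om (dt psi t)) (grad Om (dt psi t)) = (stiff dmono dmono).[t].
Proof.
move=> tab; rewrite stiffE.
by apply: ip_vec_grad_sum => // x /subset_closure Dx; rewrite dpsi_oo// dtime_polyE.
Qed.

Let grad_psi_dpsi t : t \in `]a, b[ ->
  ip_vec Om (grad Om (psi t)) (grad Om (dt psi t)) = (stiff mono dmono).[t].
Proof.
move=> tab; rewrite stiffE.
apply: ip_vec_grad_sum => // x /subset_closure Dx; last first.
  by rewrite dpsi_oo// dtime_polyE.
rewrite psi_cc ?time_polyE//; last by apply: subset_itv_oo_cc.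
by apply: eq_bigr => j _; rewrite hornerXn.
Qed.

Let pl l := time_poly e (y l).
Let sl l := time_poly c (y l).
Let quad (f : 'I_J -> {poly R}) : {poly R} := \sum_(l < J) w l *: f l.

Let quadE f t : (quad f).[t] = \sum_(l < J) w l * (f l).[t].
Proof. by rewrite horner_sum; apply: eq_bigr => l _; rewrite hornerZ. Qed.

Let potential := quad (fun l => ((2^-1)%:P - (2 * beta / 3) *: pl l) * pl l * pl l).
Let potential_rate :=
  quad (fun l => (1 - (2 * beta) *: pl l) * pl l * (pl l)^`()).
(** The quadrature term common to both tested equations. *)
Let coupling :=
  quad (fun l => (1 - (2 * beta) *: pl l) * (pl l)^`() * (sl l)^`()).

Let deriv_potential : potential^`() = potential_rate.
Proof.
rewrite /potential /potential_rate /quad linear_sum/=; apply: eq_bigr => l _.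
rewrite derivZ; congr (_ *: _); rewrite !derivM derivB derivC derivZ.
have three : (3 : R) != 0 by rewrite pnatr_eq0.
set P := pl l; set dP := P^`().
(* Writing 2 beta as 3 g, and 1 as 1/2 + 1/2 below, removes every division, so the claim holds in
   any commutative ring. *)
set g := 2 * beta / 3; have -> : 2 * beta = g * 3 by rewrite mulfVK.
have -> : (1 : {poly R}) = (2^-1)%:P + (2^-1)%:P.
  by rewrite -polyCD -div1r -splitr.
rewrite -!mul_polyC (polyCM g 3); have -> : (3%:P : {poly R}) = 3 by rewrite polyC_natr.
by ring.
Qed.

(** The energy has derivative [stiff mono dmono + potential_rate]. The second hypothesis trades the
    integral of [potential_rate] for that of [coupling], and the first leaves -alpha times the
    dissipation. Integrability is returned so that slabs can be added. *)
Lemma slab_energy :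
  \int[leb]_(t in `[a, b])
      (ip_quad w y (fun x => (1 - 2 * beta * p t x) * dt p t x) (dt psi t)
       + alpha * ip_vec Om (grad Om (dt psi t)) (grad Om (dt psi t))) =
    - (\int[leb]_(t in `[a, b])
        ip_vec Om (grad Om (psi t)) (grad Om (dt psi t))) ->
  - (\int[leb]_(t in `[a, b])
        ip_quad w y (fun x => (1 - 2 * beta * p t x) * dt psi t x) (dt p t)) =
    - (\int[leb]_(t in `[a, b])
        ip_quad w y (fun x => (1 - 2 * beta * p t x) * p t x) (dt p t)) ->
  let diss s := \int[mu]_(x in Om) (enorm (grad Om (dt psi s) x) ^+ 2) in
  leb.-integrable `[a, b] (EFin \o diss) /\
  energy_h Om w y beta (psi b) (p b) =
  energy_h Om w y beta (psi a) (p a) - alpha * \int[leb]_(s in `[a, b]) diss s.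
Proof.
move=> E1 E2 diss.
have p_oo' l t : t \in `]a, b[ -> p t (y l) = (pl l).[t].
  by move=> tab; rewrite p_cc//; apply: subset_itv_oo_cc.
have dissE : {in `]a, b[, diss =1 horner (stiff dmono dmono)}.
  move=> t tab; rewrite -grad_dpsi//; apply: eq_Rintegral => x _.
  by rewrite sqr_sqrtr// sumr_ge0// => i _; rewrite -expr2 sqr_ge0.
have F1 : {in `]a, b[, (fun t =>
      ip_quad w y (fun x => (1 - 2 * beta * p t x) * dt p t x) (dt psi t)
       + alpha * ip_vec Om (grad Om (dt psi t)) (grad Om (dt psi t))) =1
    horner (coupling + alpha *: stiff dmono dmono)}.
  move=> t tab; rewrite hornerD hornerZ grad_dpsi// quadE; congr (_ + _).
  apply: eq_bigr => l _; rewrite p_oo'// dp_oo// dpsi_oo//.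
  by rewrite !hornerE.
have F2 : {in `]a, b[, (fun t =>
        ip_quad w y (fun x => (1 - 2 * beta * p t x) * dt psi t x) (dt p t)) =1
    horner coupling}.
  move=> t tab; rewrite quadE.
  apply: eq_bigr => l _; rewrite p_oo'// dp_oo// dpsi_oo//.
  by rewrite !(hornerM, hornerD, hornerN, hornerZ, hornerC); congr (_ * _); exact: mulrAC.
have F3 : {in `]a, b[, (fun t =>
        ip_quad w y (fun x => (1 - 2 * beta * p t x) * p t x) (dt p t)) =1
    horner potential_rate}.
  move=> t tab; rewrite quadE.
  apply: eq_bigr => l _; rewrite p_oo'// dp_oo//.
  by rewrite !hornerE.
have energyE t : t \in `[a, b] -> energy_h Om w y beta (psi t) (p t) =
    (2^-1 *: stiff mono mono + potential).[t].
  move=> tab; rewrite hornerD hornerZ -grad_psi// quadE; congr (_ + _).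
    (* Pulling the factor 1/2 out of the integral requires [grad Om (psi t)] to be a genuine weak
       gradient; the expansion in t provides one. *)
    have wpsi : is_weak_grad Om (psi t) (fun x => \sum_(j < q) t ^+ j *: grad Om (c j) x).
      by apply: weak_grad_sum => // x /subset_closure Dx; rewrite psi_cc// time_polyE.
    by apply: ip_vecZ => //; exact: weak_grad_L2_vec (gradP wpsi).
  by apply: eq_bigr => l _; rewrite p_cc// !hornerE.
split; first exact: integrable_eq_horner dissE.
pose I (P : {poly R}) := \int[leb]_(t in `[a, b]) P.[t].
have ID P Q : I (P + Q) = I P + I Q.
  rewrite /I -RintegralD//; [|exact: integrable_horner..].
  by apply: eq_Rintegral => t _; rewrite hornerD.
have IZ s P : I (s *: P) = s * I P.
  rewrite /I -RintegralZl//; last exact: integrable_horner.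
  by apply: eq_Rintegral => t _; rewrite hornerZ.
move: E1 E2; rewrite (Rintegral_eq_horner F1) (Rintegral_eq_horner grad_psi_dpsi).
rewrite (Rintegral_eq_horner F2) (Rintegral_eq_horner F3) (Rintegral_eq_horner dissE).
rewrite -!/(I _) ID IZ => E1 /oppr_inj E2.
have := Rintegral_deriv_horner (2^-1 *: stiff mono mono + potential) ab.
rewrite derivD derivZ deriv_stiff deriv_potential scalerA mulVf ?pnatr_eq0//.
rewrite scale1r -/(I _) ID -E2.
rewrite !energyE ?in_itv/= ?lexx ?ltW//.
by lra.
Qed.

End slab.

(** * Gluing the slabs *)

Lemma time_grid_le (R : realType) (Tf : R) N tau m n :
  time_grid Tf N tau -> (m <= n <= N)%N -> tau m <= tau n.
Proof.
move=> [_ _ tauS] /andP[]; elim: n => [|n IH]; first by rewrite leqn0 => /eqP ->.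
rewrite leq_eqVlt => /predU1P[-> //|]; rewrite ltnS => mn nN.
exact: le_trans (IH mn (ltnW nN)) (ltW (tauS n nN)).
Qed.

Theorem lemma4 (R : realType) (d : nat) (hd : (0 < d)%N)
  (Om : set 'rV[R]_d) (hOm : bounded_domain Om)
  (M : nat) (T : 'I_M -> 'M[R]_(d.+1, d)) (hT : conforming_mesh Om T)
  (sigma : R) (hsigma : shape_regular sigma T)
  (k : nat) (hk : (1 <= k)%N) (q : nat) (hq : (1 <= q)%N)
  (Tf : R) (hTf : 0 < Tf) (N : nat) (tau : nat -> R) (htau : time_grid Tf N tau)
  (J : nat) (w : 'I_J -> R) (y : 'I_J -> 'rV[R]_d)
  (hy : forall j, closure Om (y j))
  (hw : quad_posdef (closure Om) (Vh Om T k) w y)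
  (alpha beta : R) (halpha : 0 <= alpha) (hbeta : 0 <= beta)
  (psi0 p0 : 'rV[R]_d -> R) (hpsi0 : Vh Om T k psi0) (hp0 : Vh Om T k p0)
  (psi p : R -> 'rV[R]_d -> R)
  (hpsi : cPr N tau q (Vh Om T k) (closure Om) psi)
  (hp : cPr N tau q (Vh Om T k) (closure Om) p)
  (psi_init : {in closure Om, psi 0 =1 psi0})
  (p_init : {in closure Om, p 0 =1 p0})
  (eq_eta : forall m n : nat, (m <= n <= N)%N ->
    forall eta : R -> 'rV[R]_d -> R,
      Pr N tau q.-1 (Vh Om T k) (closure Om) eta ->
    \int[lebesgue_measure]_(t in `[tau m, tau n])
      (ip_quad w y (fun x => (1 - 2 * beta * p t x) * dt p t x) (eta t)
       + alpha * ip_vec Om (grad Om (dt psi t)) (grad Om (eta t))) =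
    - \int[lebesgue_measure]_(t in `[tau m, tau n])
        ip_vec Om (grad Om (psi t)) (grad Om (eta t)))
  (eq_q : forall m n : nat, (m <= n <= N)%N ->
    forall qt : R -> 'rV[R]_d -> R,
      Pr N tau q.-1 (Vh Om T k) (closure Om) qt ->
    - (\int[lebesgue_measure]_(t in `[tau m, tau n])
        ip_quad w y (fun x => (1 - 2 * beta * p t x) * dt psi t x) (qt t)) =
    - (\int[lebesgue_measure]_(t in `[tau m, tau n])
        ip_quad w y (fun x => (1 - 2 * beta * p t x) * p t x) (qt t))) :
  forall m n : nat, (m <= n <= N)%N ->
    energy_h Om w y beta (psi (tau n)) (p (tau n)) =
    energy_h Om w y beta (psi (tau m)) (p (tau m))
    - alpha * \int[lebesgue_measure]_(s in `[tau m, tau n])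
        \int[lebesgue_rV R d]_(x in Om) (enorm (grad Om (dt psi s) x) ^+ 2).
Proof.
(* With q = q' + 1 the test space has degree q', as delivered by [Pr_dt]. *)
case: q hq hpsi hp eq_eta eq_q => // q' _ hpsi [Pp Cp] eq_eta eq_q.
have [Ppsi Cpsi] := hpsi.
have [oOm _ _ bOm] := hOm.
have fOm := lebesgue_rV_bounded (open_measurable_rV oOm) bOm.
pose diss s := \int[lebesgue_rV R d]_(x in Om) (enorm (grad Om (dt psi s) x) ^+ 2).
pose E n := energy_h Om w y beta (psi (tau n)) (p (tau n)).
have tauS n : (n < N)%N -> tau n < tau n.+1 by have [_ _] := htau; exact.
have step n : (n < N)%N ->
    lebesgue_measure.-integrable `[tau n, tau n.+1] (EFin \o diss) /\
    E n.+1 = E n - alpha * \int[lebesgue_measure]_(s in `[tau n, tau n.+1]) diss s.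
  move=> nN; have [c [Vc cE]] := Ppsi n nN; have [e [_ eE]] := Pp n nN.
  have sub : `[tau n, tau n.+1] `<=` `[tau 0, tau N].
    move=> t /=; rewrite !in_itv/= => /andP[nt tn].
    rewrite (le_trans _ nt) ?(le_trans tn)//.
      by apply: time_grid_le htau _; rewrite nN leqnn.
    by apply: time_grid_le htau _; rewrite leq0n ltnW.
  have nnN : (n <= n.+1 <= N)%N by rewrite leqnSn.
  apply: (slab_energy oOm fOm hy (tauS n nN) _ _ _ cE eE).
  - by move=> j; have [] := Vc j.
  - by move=> x Dx; apply: continuous_subspaceW sub _; exact: Cpsi.
  - by move=> x Dx; apply: continuous_subspaceW sub _; exact: Cp.
  - by apply: eq_eta => //; exact: Pr_dt.
  - by apply: eq_q => //; exact: Pr_dt.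
move=> m n /andP[mn nN].
(* The degenerate interval is treated apart, as [slab_energy] assumes a < b. *)
have base : lebesgue_measure.-integrable `[tau m, tau m] (EFin \o diss) /\
    E m = E m - alpha * \int[lebesgue_measure]_(s in `[tau m, tau m]) diss s.
  rewrite set_itv1 Rintegral_set1 mulr0 subr0; split => //.
  apply: null_set_integrable => //; last exact: lebesgue_measure_set1.
  exact: measurable_fun_set1.
suff [] : lebesgue_measure.-integrable `[tau m, tau n] (EFin \o diss) /\
    E n = E m - alpha * \int[lebesgue_measure]_(s in `[tau m, tau n]) diss s by [].
elim: n mn nN => [|n IH].
  by rewrite leqn0 => /eqP m0 _; move: base; rewrite m0.
rewrite leq_eqVlt => /predU1P[<- _ //|].
rewrite ltnS => mn nN; have [i1 E1] := IH mn (ltnW nN); have [i2 E2] := step n nN.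
have mtn : tau m <= tau n by apply: time_grid_le htau _; rewrite mn ltnW.
(* The shared grid point is removed to make the union disjoint; it does not change the integral. *)
have ioc : lebesgue_measure.-integrable `]tau n, tau n.+1] (EFin \o diss).
  by apply: integrableS i2 => //; exact: subset_itv_oc_cc.
have dis : [disjoint `[tau m, tau n] & `]tau n, tau n.+1]].
  apply/disj_setPS => t [/=]; rewrite !in_itv/= => /andP[_ tn] /andP[nt _].
  by have := lt_le_trans nt tn; rewrite ltxx.
have itvE : `[tau m, tau n.+1]%classic = `[tau m, tau n] `|` `]tau n, tau n.+1].
  by rewrite -itv_bndbnd_setU ?bnd_simp// ltW// tauS.
have iU : lebesgue_measure.-integrable
    (`[tau m, tau n] `|` `]tau n, tau n.+1]) (EFin \o diss).
  by apply: integrable_setU_disj.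
rewrite itvE; split; first exact: iU.
rewrite E2 E1 Rintegral_setU//.
by rewrite Rintegral_itv_obnd_cbnd// mulrDr opprD addrA.
Qed.
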